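(* Let $B$ be a compact connected Riemann surface equipped with a Riemannian metric $d$, let $U$ be a finite union of disjoint closed discs in $B$, let $B_1=B\setminus U$ and $b_1\in B_1$, and fix a simple base $\alpha_1,\dots,\alpha_k$ of $\pi_1(B_1,b_1)$. Then there exist $A>0$ and $L>0$ satisfying the following property. For any finite subset $S\subset B_1$, there exist $b\in B_1\setminus S$ and piecewise smooth loops $\gamma_1,\dots,\gamma_k\subset B_1\setminus S$ based at $b$, with $\gamma_i$ representing $\alpha_i$ up to a single conjugation, such that for every $i=1,\dots,k$, $$\mathrm{length}_{d_{B_1\setminus S}}(\gamma_i)\le L(\#S+1)$$ and, if $S\neq\varnothing$, $V(\gamma_i,A(\#S)^{-1})\subset B_1\setminus S$.
   Context: A loop $\gamma\colon[0,1]\to X$ in a surface is simple if it is non-nullhomotopic and injective on $[0,1)$. A simple base of $\pi_1(B_1,b_1)$ is a canonical system of generators $\alpha_1,\dots,\alpha_k$ such that each $\alpha_i$ is represented by a simple piecewise smooth closed loop in $B_1$ based at $b_1$ (here $B_1$ is viewed as the interior of an orientable connected compact surface, possibly with boundary). A collection $\{c_{b_1b}\}_{b\in B_1}$ of smooth directed paths in $B_1$ of bounded $d$-length is fixed once and for all, $c_{b_1b}$ going from $b_1$ to $b$; a loop $\gamma$ based at $b$ represents $\alpha_i$ up to a single conjugation if the loop at $b_1$ obtained by following $c_{b_1b}$, then $\gamma$, then $c_{b_1b}^{-1}$ has class $\alpha_i$ in $\pi_1(B_1,b_1)$. For $\Omega\subset B$ and $r\ge0$, $V(\Omega,r)=\{x\in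 B\colon d(x,\Omega)\le r\}$. For a complex manifold $X$, $d_X$ is the Kobayashi (pseudo-)hyperbolic metric, with infinitesimal form $\lambda_X(x,v)=\inf\frac2R$ over all $R>0$ for which there is a holomorphic map $h\colon\{z\in\mathbb{C}\colon|z|<R\}\to X$ with $h(0)=x$, $h'(0)=v$; $\mathrm{length}_{d_X}(\gamma)=\int_0^1\lambda_X(\gamma(t),\gamma'(t))\,dt$. *)

(* Defs.v *)
From HB Require Import structures.
From mathcomp Require Import all_boot all_order all_algebra finmap.
From mathcomp Require Import complex.
From mathcomp Require Import all_classical all_reals all_analysis.
Import numFieldNormedType.Exports.
Import Order.TTheory GRing.Theory Num.Theory.

Set Implicit Arguments.
Unset Strict Implicit.
Unset Printing Implicit Defensive.

Local Open Scope ring_scope.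
Local Open Scope complex_scope.
Local Open Scope classical_set_scope.

(* The field R[i], typed as a numFieldType so that it carries the topology of
   its modulus and so that [derivable _ _ 1] and [derive1] are complex
   differentiability and the complex derivative. *)
Definition Cplx (R : realType) : numFieldType := R[i].

Section RiemannSurface.
Variables (R : realType) (T : topologicalType).
Local Notation C := (Cplx R).

Record chart := Chart {
  cdom : set T;
  cmap : T -> C;
  cinv : C -> T;
  cdom_open : open cdom;
  cimg_open : open (cmap @` cdom);
  cmapK : forall x, cdom x -> cinv (cmap x) = x;
  cmap_continuous : forall x, cdom x -> {for x, continuous cmap};
  cinv_continuous : forall x, cdom x -> {for cmap x, continuous cinv} }.

(* Connectedness and compactness are stated separately; second countability
   is automatic in the compact case. *)
Record riemann_surface := RiemannSurface {
  rs_hausdorff : hausdorff_space T;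
  atlas : set chart;
  atlas_cover : forall x, exists c, atlas c /\ cdom c x;
  atlas_holomorphic : forall c c', atlas c -> atlas c' ->
    forall x, cdom c x -> cdom c' x ->
    derivable (cmap c' \o cinv c) (cmap c x) 1 }.

Definition chart_at (B : riemann_surface) (x : T) : chart :=
  projT1 (cid (atlas_cover B x)).

Definition closed_disc (D : set T) :=
  exists f : C -> T, [/\ {within [set z : C | `|z| <= 1], continuous f},
    set_inj [set z : C | `|z| <= 1] f & D = f @` [set z : C | `|z| <= 1]].

End RiemannSurface.

Section Smoothness.
Variable R : realType.
Local Notation C := (Cplx R).

Definition smooth_fun (g : R -> R) :=
  forall (n : nat) (t : R), derivable (derive1n n g) t 1.

(* Real directional derivatives on C = R^2. *)
Definition pderivable (f : C -> R) (v z : C) :=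
  derivable (fun t : R => f (z + t%:C * v)) 0 1.

Definition pderive (f : C -> R) (v z : C) : R :=
  derive1 (fun t : R => f (z + t%:C * v)) 0.

Fixpoint C_on (n : nat) (O : set C) (f : C -> R) : Prop :=
  (forall z, O z -> {for z, continuous f}) /\
  match n with
  | 0 => True
  | m.+1 => forall v : C, v = 1 \/ v = 'i ->
      (forall z, O z -> pderivable f v z) /\ C_on m O (pderive f v)
  end.

Definition smooth_on (O : set C) (f : C -> R) := forall n, C_on n O f.

End Smoothness.

(* Paths are functions R -> T of which only the restriction to [0, 1] (or to
   the interval under consideration) matters. *)
Section Paths.
Variables (R : realType) (T : topologicalType).
Implicit Types (X : set T) (x y : T) (p q : R -> T).
Local Notation C := (Cplx R).

Definition path_in X x y p :=
  [/\ {within `[0, 1], continuous p}, p 0 = x, p 1 = y & p @` `[0, 1] `<=` X].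

Definition loop_in X x p := path_in X x x p.

Definition path_concat p q (t : R) : T :=
  if t <= 2^-1 then p (2 * t) else q (2 * t - 1).

Definition path_rev p (t : R) : T := p (1 - t).

Definition path_homotopic X p q :=
  exists H : R * R -> T,
    [/\ {within `[0, 1] `*` `[0, 1], continuous H},
        H @` (`[0, 1] `*` `[0, 1]) `<=` X,
        forall t, t \in `[0, 1] -> H (0, t) = p t,
        forall t, t \in `[0, 1] -> H (1, t) = q t
      & forall s, s \in `[0, 1] -> H (s, 0) = p 0 /\ H (s, 1) = p 1].

(* The elements of the fundamental group are the homotopy classes themselves,
   as sets of loops; the product, inverse and unit are the induced ones. *)
Definition loop_class X x p : set (R -> T) :=
  [set q | loop_in X x q /\ path_homotopic X p q].

Definition pi1 X x : set (set (R -> T)) :=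
  [set loop_class X x p | p in loop_in X x].

Definition pi1_one X x : set (R -> T) := loop_class X x (cst x).

Definition pi1_mul X x (a b : set (R -> T)) : set (R -> T) :=
  \bigcup_(p in a) \bigcup_(q in b) loop_class X x (path_concat p q).

Definition pi1_inv X x (a : set (R -> T)) : set (R -> T) :=
  \bigcup_(p in a) loop_class X x (path_rev p).

Variable B : riemann_surface R T.

(* Smooth up to the endpoints: in a chart the path locally extends to a
   C^infinity map on R. *)
Definition smooth_path (a b : R) p :=
  forall t, a <= t <= b ->
  exists c : chart R T, exists g1 g2 : R -> R,
    [/\ atlas B c, smooth_fun g1, smooth_fun g2, cdom c (p t)
      & \forall u \near t, a <= u <= b ->
          cdom c (p u) /\ cmap c (p u) = (g1 u +i* g2 u : R[i])].

Definition piecewise_smooth p :=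
  exists s : seq R, itv_partition 0 1 s /\
    forall i, (i < size s)%N ->
      smooth_path (nth 0 (0 :: s) i) (nth 0 s i) p.

(* The coordinate in the chart c of the velocity vector p'(t). *)
Definition velocity (c : chart R T) p (t : R) : C :=
  (derive1 (fun u : R => complex.Re (cmap c (p u))) t +i*
   derive1 (fun u : R => complex.Im (cmap c (p u))) t : R[i]).

End Paths.

Section RiemannianMetric.
Variables (R : realType) (T : topologicalType) (B : riemann_surface R T).
Local Notation C := (Cplx R).

(* E dx^2 + 2 F dx dy + G dy^2, evaluated on the vector v. *)
Definition quad_form (E F G : R) (v : C) : R :=
  E * complex.Re v ^+ 2 + 2 * F * (complex.Re v * complex.Im v)
    + G * complex.Im v ^+ 2.

(* The coefficients in each chart; the last axiom is invariance under changes
   of charts, whose differential is multiplication by a complex derivative. *)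
Record riemannian_metric := RiemannianMetric {
  rmE : chart R T -> C -> R;
  rmF : chart R T -> C -> R;
  rmG : chart R T -> C -> R;
  rm_form := fun c z => quad_form (rmE c z) (rmF c z) (rmG c z);
  rm_smooth : forall c, atlas B c ->
    [/\ smooth_on (cmap c @` cdom c) (rmE c),
        smooth_on (cmap c @` cdom c) (rmF c)
      & smooth_on (cmap c @` cdom c) (rmG c)];
  rm_pos : forall c, atlas B c -> forall x, cdom c x ->
    forall v : C, v != 0 -> 0 < rm_form c (cmap c x) v;
  rm_compat : forall c c', atlas B c -> atlas B c' ->
    forall x, cdom c x -> cdom c' x -> forall v : C,
    rm_form c (cmap c x) v =
    rm_form c' (cmap c' x) (derive1 (cmap c' \o cinv c) (cmap c x) * v) }.

Variable d : riemannian_metric.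

(* The integrand depends on a chart only at the breakpoints of a piecewise
   smooth path. *)
Definition riem_length (p : R -> T) : \bar R :=
  (\int[@lebesgue_measure R]_(t in `[0%R, 1%R])
     (Num.sqrt (rm_form d (chart_at B (p t))
        (cmap (chart_at B (p t)) (p t))
        (velocity (chart_at B (p t)) p t)))%:E)%E.

Definition riem_dist (x y : T) : \bar R :=
  ereal_inf [set riem_length p |
    p in [set p | path_in [set: T] x y p /\ piecewise_smooth B p]].

Definition riem_dist_set (x : T) (W : set T) : \bar R :=
  ereal_inf [set riem_dist x y | y in W].

Definition tube (W : set T) (r : R) : set T :=
  [set x | (riem_dist_set x W <= r%:E)%E].

End RiemannianMetric.

Section Kobayashi.
Variables (R : realType) (T : topologicalType) (B : riemann_surface R T).
Local Notation C := (Cplx R).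

Definition holomorphic_disc (X : set T) (rho : R) (h : C -> T) :=
  forall z : C, `|z| < rho%:C ->
    [/\ X (h z), {for z, continuous h}
      & forall c, atlas B c -> cdom c (h z) -> derivable (cmap c \o h) z 1].

(* lambda_X(x, v) for the open subset X of B, the tangent vector v at x being
   given by its coordinate in the chart c. *)
Definition kobayashi (X : set T) (c : chart R T) (x : T) (v : C) : \bar R :=
  ereal_inf [set (2 / rho)%:E | rho in [set rho : R | 0 < rho /\
    exists h : C -> T, [/\ holomorphic_disc X rho h, h 0 = x
                         & derive1 (cmap c \o h) 0 = v]]].

Definition kobayashi_length (X : set T) (p : R -> T) : \bar R :=
  (\int[@lebesgue_measure R]_(t in `[0%R, 1%R])
     kobayashi X (chart_at B (p t)) (p t)
       (velocity (chart_at B (p t)) p t))%E.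

End Kobayashi.

(* The letter (i, false) stands for the i-th generator, (i, true) for its
   inverse. *)
Definition word (I : Type) := seq (I * bool).

Inductive word_eq (I : Type) (rel : set (word I)) : word I -> word I -> Prop :=
| word_eq_refl u : word_eq rel u u
| word_eq_sym u v : word_eq rel u v -> word_eq rel v u
| word_eq_trans u v w : word_eq rel u v -> word_eq rel v w -> word_eq rel u w
| word_eq_cancel u v i e :
    word_eq rel (u ++ [:: (i, e); (i, ~~ e)] ++ v) (u ++ v)
| word_eq_rel u v w : rel w -> word_eq rel (u ++ w ++ v) (u ++ v).

(* [a_1, b_1] ... [a_g, b_g] c_1 ... c_r, with a_(j+1) numbered 2j, b_(j+1)
   numbered 2j+1 and c_(l+1) numbered 2g+l. *)
Definition surface_word (g r : nat) : word nat :=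
  flatten [seq [:: (j.*2, false); (j.*2.+1, false);
                   (j.*2, true); (j.*2.+1, true)] | j <- iota 0 g]
  ++ [seq ((g.*2 + l)%N, false) | l <- iota 0 r].

Section SimpleBase.
Variables (R : realType) (T : topologicalType) (B : riemann_surface R T).
Variables (X : set T) (x : T) (k : nat) (alpha : 'I_k -> set (R -> T)).

Definition eval_word (w : word 'I_k) : set (R -> T) :=
  foldr (fun l a => pi1_mul X x
           (if l.2 then pi1_inv X x (alpha l.1) else alpha l.1) a)
        (pi1_one X x) w.

Definition presents (rel : set (word 'I_k)) :=
  [/\ forall i, pi1 X x (alpha i),
      forall a, pi1 X x a -> exists w, eval_word w = a
    & forall w, eval_word w = pi1_one X x <-> word_eq rel w [::]].

(* r is the number of boundary components of the compact surface of which X is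
   the interior. Both usual normal forms are covered: the one-relator
   presentation including all boundary generators and, when r > 0, the free
   basis obtained by omitting one of them. *)
Definition canonical_system (r : nat) :=
  exists g : nat,
    (k = (g.*2 + r)%N /\
     presents [set w | [seq (val l.1, l.2) | l <- w] = surface_word g r])
    \/ [/\ (0 < r)%N, k = (g.*2 + r).-1 & presents set0].

Definition simple_loop (p : R -> T) :=
  [/\ loop_in X x p, set_inj `[0, 1[ p & ~ path_homotopic X p (cst x)].

Definition simple_base (r : nat) :=
  canonical_system r /\
  forall i, exists p, [/\ alpha i p, simple_loop p & piecewise_smooth B p].

End SimpleBase.

Definition connecting_paths (R : realType) (T : topologicalType)
    (B : riemann_surface R T) (d : riemannian_metric B)
    (X : set T) (x : T) (c : T -> R -> T) :=
  (forall y, X y -> path_in X x y (c y) /\ smooth_path B 0 1 (c y)) /\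
  exists M : R, forall y, X y -> (riem_length d (c y) <= M%:E)%E.

(* c is the path from the base point of the fundamental group to the base point
   of the loop p, and a is an element of that group. *)
Definition represents_up_to_conj (R : realType) (T : topologicalType)
    (c p : R -> T) (a : set (R -> T)) :=
  a (path_concat (path_concat c p) (path_rev c)).

(* Main.v *)
(** Perturb fixed loops so that they avoid a neighbourhood of [S] of size
    [A / (#S + 1)]; the Kobayashi bound then comes for free, because a coordinate
    disc of radius [e] around [x] inside [X] gives [lambda_X(x, v) <= 2 |v| / e].

    A loop is covered by finitely many small coordinate squares.  In a square a
    horizontal or vertical line is good when it stays [e]-far from every line
    of the same direction through a point of [S]; with [e = A / (#S + 1)] the bad
    lines have total measure at most [2 A].  Good lines of one square meet, and
    in an overlap of two squares a good line of the first crosses a good line of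
    the second by the intermediate value theorem, so the loop can be followed,
    up to homotopy inside simply connected squares, by boundedly many good
    segments.

    The prescribed paths [c_b] may wind arbitrarily, but [pi_1] is countable:
    by countable subadditivity of Lebesgue measure, one homotopy class of [c_b]
    (closed up inside a square around [b_1]) occurs for a set of heights of [b]
    that cannot be covered by [n] intervals of length [A / n], for some [A > 0],
    and [b] can be chosen there on a good line. *)

Require Import Defs.
From HB Require Import structures.
From mathcomp Require Import all_boot all_order all_algebra finmap.
From mathcomp Require Import complex.
From mathcomp Require Import all_classical all_reals all_analysis.
From mathcomp Require Import measurable_realfun.
From mathcomp Require Import ring lra.
Import numFieldNormedType.Exports.
Set Implicit Arguments.
Unset Strict Implicit.
Unset Printing Implicit Defensive.
Import Order.TTheory GRing.Theory Num.Theory.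
Local Open Scope fset_scope.
Local Open Scope ring_scope.
Local Open Scope classical_set_scope.

(** * The complex plane *)


Section ComplexPlane.
Variable R : realType.
Local Notation C := (Cplx R).
Implicit Types (z w : C) (a b : R).

(** Every constant has to be fixed before [S] is known. So [fat] and [reach] state their constants
    ahead of the quantifier over [S], and a crossing of two squares uses intervals of candidate
    lines fixed beforehand. One good line through a point clears a whole coordinate square of
    half-side [e]: a point of [S] that is [e]-far in one coordinate lies outside it. With a lower
    bound of the metric in the chart, the same square also bounds from below the distance to the
    complement of [B1 \ S].

    Homotopies are only needed in [B1] and may cross [S]; the loops themselves may not.

    The obstacle is the base point, since [c_b] carries no continuity in [b]. The heights at which
    [c_b] closes up to a given class have no reason to form a measurable set, so largeness is
    expressed by coverings. On a large set this class is a fixed [q]. The loops followed along good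
    lines are then [q^-1 p q], where [p] represents a generator, and conjugation by [c_b] undoes
    [q]. Countability of the group comes from words in the generators. *)

Definition mkC a b : C := (a +i* b : R[i])%C.
Definition ReC z : R := complex.Re z.
Definition ImC z : R := complex.Im z.

Lemma mkC_eta z : mkC (ReC z) (ImC z) = z. Proof. by case: z. Qed.
Lemma ReC_mk a b : ReC (mkC a b) = a. Proof. by []. Qed.
Lemma ImC_mk a b : ImC (mkC a b) = b. Proof. by []. Qed.
Lemma C_ext z w : ReC z = ReC w -> ImC z = ImC w -> z = w.
Proof. by case: z => a b; case: w => c d; rewrite /ReC /ImC /= => -> ->. Qed.
Lemma ReCD z w : ReC (z + w) = ReC z + ReC w. Proof. by case: z; case: w. Qed.
Lemma ImCD z w : ImC (z + w) = ImC z + ImC w. Proof. by case: z; case: w. Qed.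
Lemma ReCN z : ReC (- z) = - ReC z. Proof. by case: z. Qed.
Lemma ImCN z : ImC (- z) = - ImC z. Proof. by case: z. Qed.
Lemma ReCM z w : ReC (z * w) = ReC z * ReC w - ImC z * ImC w.
Proof. by case: z; case: w. Qed.
Lemma ImCM z w : ImC (z * w) = ReC z * ImC w + ImC z * ReC w.
Proof. by case: z => a b; case: w => c d; rewrite /ImC /= addrC [b * c]mulrC [X in _ + X]mulrC addrC mulrC. Qed.
Lemma ReC0 : ReC 0 = 0. Proof. by []. Qed.
Lemma ImC0 : ImC 0 = 0. Proof. by []. Qed.
Definition ReImC := (ReC_mk, ImC_mk, ReCD, ImCD, ReCN, ImCN, ReCM, ImCM, ReC0, ImC0).

Lemma normC_ltE z a : (`|z| < (a%:C)%C :> C) =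
  (Num.sqrt (ReC z ^+ 2 + ImC z ^+ 2) < a).
Proof. by rewrite /Cplx normc_def ltcR. Qed.

Lemma ReC_le_sqrt z : `|ReC z| <= Num.sqrt (ReC z ^+ 2 + ImC z ^+ 2).
Proof. by rewrite -sqrtr_sqr ler_sqrt ?addr_ge0 ?sqr_ge0// lerDl sqr_ge0. Qed.
Lemma ImC_le_sqrt z : `|ImC z| <= Num.sqrt (ReC z ^+ 2 + ImC z ^+ 2).
Proof. by rewrite -sqrtr_sqr ler_sqrt ?addr_ge0 ?sqr_ge0// lerDr sqr_ge0. Qed.
Lemma sqrt_le_ReImC z : Num.sqrt (ReC z ^+ 2 + ImC z ^+ 2) <= `|ReC z| + `|ImC z|.
Proof.
rewrite -[leRHS]ger0_norm ?addr_ge0// -[leRHS]sqrtr_sqr ler_sqrt ?sqr_ge0//.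
rewrite sqrrD !real_normK ?num_real// addrAC lerDl mulrn_wge0// mulr_ge0//.
Qed.

(** The order of [R[i]] only compares numbers with equal imaginary parts, so a positive radius is
    automatically real. *)
Lemma posC_real (e : C) : 0 < e -> exists2 a, 0 < a & e = (a%:C)%C.
Proof.
case: e => a b; rewrite ltcE/= => /andP[/eqP -> a0]; by exists a.
Qed.

(** Squares replace discs throughout, because good lines control the two coordinates separately. *)
Lemma nbhsC_sq z (U : set C) : nbhs z U <->
  exists2 a, 0 < a & forall w, `|ReC w - ReC z| < a -> `|ImC w - ImC z| < a -> U w.
Proof.
split.
  move=> /nbhs_normP[e /= /posC_real[a a0 ->] eU].
  exists (a / 2); first by rewrite divr_gt0.
  move=> w wr wi; apply: eU => /=; rewrite normC_ltE.
  apply: le_lt_trans (sqrt_le_ReImC _) _.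
  rewrite !ReImC (distrC (ReC z)) (distrC (ImC z)); lra.
move=> [a a0 aU]; apply/nbhs_normP; exists (a%:C)%C; first by rewrite /= ltcR.
move=> w /=; rewrite normC_ltE => zw; apply: aU; rewrite distrC.
  by apply: le_lt_trans zw; rewrite -[X in `|X|](_ : ReC (z - w) = _) ?ReC_le_sqrt// !ReImC.
by apply: le_lt_trans zw; rewrite -[X in `|X|](_ : ImC (z - w) = _) ?ImC_le_sqrt// !ReImC.
Qed.

Lemma continuous_ReC : continuous ReC.
Proof.
move=> z; apply/(@cvgrPdist_lt _ _ _ (nbhs z) (nbhs_filter z)) => e e0; apply/nbhsC_sq; exists e => // w wr _.
by rewrite /= distrC.
Qed.

Lemma continuous_ImC : continuous ImC.
Proof.
move=> z; apply/(@cvgrPdist_lt _ _ _ (nbhs z) (nbhs_filter z)) => e e0; apply/nbhsC_sq; exists e => // w _ wi.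
by rewrite /= distrC.
Qed.

Lemma cvgC_pair (X : Type) (F : set_system X) {FF : Filter F} (f : X -> C) z :
  ReC \o f @ F --> ReC z -> ImC \o f @ F --> ImC z -> f @ F --> z.
Proof.
move=> /cvgrPdist_lt fr /cvgrPdist_lt fi U /nbhsC_sq[a a0 aU].
have fra := fr a a0; have fia := fi a a0; change (F [set x | U (f x)]).
by near=> x; apply: aU; rewrite distrC; near: x.
Unshelve. all: by end_near. Qed.

Lemma continuousC_pair (X : topologicalType) (f : X -> C) x :
  {for x, continuous (ReC \o f)} -> {for x, continuous (ImC \o f)} ->
  {for x, continuous f}.
Proof. exact: cvgC_pair. Qed.

End ComplexPlane.

(** * Paths and homotopies *)


Section RealContinuity.
Variables (R : realType) (X : topologicalType).
Implicit Types f g : X -> R.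

Lemma contD f g : continuous f -> continuous g -> continuous (fun x => f x + g x).
Proof. by move=> cf cg x; apply: cvgD; [exact: cf|exact: cg]. Qed.
Lemma contM f g : continuous f -> continuous g -> continuous (fun x => f x * g x).
Proof. by move=> cf cg x; apply: cvgM; [exact: cf|exact: cg]. Qed.
Lemma contN f : continuous f -> continuous (fun x => - f x).
Proof. by move=> cf x; apply: cvgN; exact: cf. Qed.
Lemma contK (a : R) : continuous (fun _ : X => a).
Proof. by move=> x; exact: cvg_cst. Qed.
Lemma cont_min f g : continuous f -> continuous g -> continuous (fun x => Num.min (f x) (g x)).
Proof. by move=> cf cg x; apply: continuous_min; [exact: cf|exact: cg]. Qed.
Lemma cont_max f g : continuous f -> continuous g -> continuous (fun x => Num.max (f x) (g x)).
Proof. by move=> cf cg x; apply: continuous_max; [exact: cf|exact: cg]. Qed.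
Lemma cont_id : continuous (fun x : X => x).
Proof. by move=> x; exact: cvg_id. Qed.
End RealContinuity.

Lemma cont_comp (X Y Z : topologicalType) (f : X -> Y) (g : Y -> Z) :
  continuous f -> continuous g -> continuous (fun x => g (f x)).
Proof. by move=> cf cg x; apply: continuous_comp; [exact: cf|exact: cg]. Qed.

Lemma cont_fst (X Y : topologicalType) : continuous (fun p : X * Y => p.1).
Proof. by move=> x; exact: cvg_fst. Qed.
Lemma cont_snd (X Y : topologicalType) : continuous (fun p : X * Y => p.2).
Proof. by move=> x; exact: cvg_snd. Qed.
Lemma cont_pair (X Y Z : topologicalType) (f : X -> Y) (g : X -> Z) :
  continuous f -> continuous g -> continuous (fun x => (f x, g x)).
Proof. by move=> cf cg x; apply: cvg_pair; [exact: cf|exact: cg]. Qed.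

Ltac cont := repeat first [exact: cont_fst | exact: cont_snd | exact: contK
  | exact: cont_id | assumption
  | apply: cont_min | apply: cont_max | apply: contD | apply: contM
  | apply: contN | apply: cont_pair ].

Section Clamp.
Variable R : realType.
(** A retraction of the line onto the unit interval. Composing with it turns continuity within the
    interval into global continuity, for paths and, in both variables, for homotopies. *)
Definition clamp (t : R) : R := Num.max 0 (Num.min 1 t).
Lemma clamp_itv t : 0 <= clamp t <= 1.
Proof. by rewrite le_max lexx/= ge_max ler01/= ge_min lexx. Qed.
Lemma clamp_id t : 0 <= t <= 1 -> clamp t = t.
Proof. by case/andP => t0 t1; rewrite /clamp (min_idPr t1) (max_idPr t0). Qed.
Lemma continuous_clamp : continuous clamp.
Proof. rewrite /clamp; cont. Qed.
End Clamp.
Arguments clamp {R} t.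


Lemma within_retract (X Y Z : topologicalType) (A : set X) (f : X -> Y) (r : Z -> X) :
  {within A, continuous f} -> continuous r -> (forall z, A (r z)) ->
  continuous (fun z => f (r z)).
Proof.
move=> /subspace_continuousP cf cr Ar z U fU.
have h : nbhs (r z) [set y | A y -> U (f y)] := cf _ (Ar z) _ fU.
have h' : nbhs z (r @^-1` [set y | A y -> U (f y)]) := cr z _ h.
change (nbhs z [set w | U (f (r w))]).
by apply: filterS h' => w /=; exact.
Qed.

Lemma continuous_within_eq (X Y : topologicalType) (A : set X) (f g : X -> Y) :
  continuous g -> (forall x, A x -> f x = g x) -> {within A, continuous f}.
Proof.
move=> cg fg; apply/subspace_continuousP => x Ax U fU; change (nbhs x [set y | A y -> U (f y)]).
have {}fU : nbhs (g x) U by rewrite -fg.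
have gU : nbhs x (g @^-1` U) := cg x U fU.
by apply: filterS gU => y gy Ay; rewrite fg.
Qed.

Lemma pasting (R : realType) (X Y : topologicalType) (h : X -> R) (a : R) (f g : X -> Y) :
  continuous h -> continuous f -> continuous g -> (forall x, h x = a -> f x = g x) ->
  continuous (fun x => if h x <= a then f x else g x).
Proof.
move=> ch cf cg fg x U /= xU.
change (nbhs x [set y | U (if h y <= a then f y else g y)]).
have [ha|ha|ha] := ltgtP (h x) a.
- rewrite (ltW ha) in xU.
  have : nbhs x [set y | h y < a].
    by apply: (ch x [set u | u < a]); exact: lt_nbhsl.
  move=> h1; have h2 := cf x U xU.
  by apply: filterS2 h1 h2 => y /= hy; rewrite (ltW hy).
- rewrite leNgt ha/= in xU.
  have : nbhs x [set y | a < h y].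
    by apply: (ch x [set u | a < u]); exact: lt_nbhsr.
  move=> h1; have h2 := cg x U xU.
  by apply: filterS2 h1 h2 => y /= hy; rewrite leNgt hy.
- rewrite ha lexx in xU.
  have h1 : nbhs x (f @^-1` U) := cf x U xU.
  have gxU : nbhs (g x) U by rewrite -fg.
  have h2 : nbhs x (g @^-1` U) := cg x U gxU.
  by apply: filterS2 h1 h2 => y /=; case: ifP.
Qed.

Section Homotopy.
Variables (R : realType) (T : topologicalType) (X : set T).
Implicit Types (x y z w : T) (p q : R -> T).

Lemma path_inE x y p : path_in X x y p ->
  [/\ continuous (fun t => p (clamp t)), p 0 = x, p 1 = y &
      forall t, 0 <= t <= 1 -> X (p t)].
Proof.
move=> [cp p0 p1 pX]; split=> //.
  apply: (@within_retract R T R _ p clamp cp); first exact: continuous_clamp.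
  by move=> t; rewrite /= in_itv/= clamp_itv.
by move=> t t01; apply: pX; exists t => //=; rewrite in_itv.
Qed.

Lemma path_inI x y p g : continuous g -> (forall t, 0 <= t <= 1 -> p t = g t) ->
  p 0 = x -> p 1 = y -> (forall t, 0 <= t <= 1 -> X (p t)) -> path_in X x y p.
Proof.
move=> cg pg p0 p1 pX; split=> //.
  by apply: (@continuous_within_eq _ _ _ p g cg) => t /=; rewrite in_itv/=; exact: pg.
by move=> _ [t /= + <-]; rewrite in_itv/=; exact: pX.
Qed.

Lemma mem01 (t : R) : (t \in `[0, 1]) = (0 <= t <= 1).
Proof. by apply/idP/idP; rewrite inE/= in_itv. Qed.

Lemma homotopicI p q (H : R * R -> T) : continuous H ->
  (forall s t, 0 <= s <= 1 -> 0 <= t <= 1 -> X (H (s, t))) ->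
  (forall t, 0 <= t <= 1 -> H (0, t) = p t) ->
  (forall t, 0 <= t <= 1 -> H (1, t) = q t) ->
  (forall s, 0 <= s <= 1 -> H (s, 0) = p 0 /\ H (s, 1) = p 1) ->
  path_homotopic X p q.
Proof.
move=> cH HX H0 H1 He; exists H; split.
- exact: (@continuous_within_eq _ _ _ H H cH).
- by move=> _ [[s t] /= [/= + +] <-]; rewrite !in_itv/=; exact: HX.
- by move=> t; rewrite mem01; exact: H0.
- by move=> t; rewrite mem01; exact: H1.
- by move=> s; rewrite mem01; exact: He.
Qed.

Lemma homotopicE p q : path_homotopic X p q -> exists H : R * R -> T,
  [/\ continuous H, (forall s t, X (H (s, t))),
      (forall t, 0 <= t <= 1 -> H (0, t) = p t),
      (forall t, 0 <= t <= 1 -> H (1, t) = q t)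
    & (forall s, H (s, 0) = p 0 /\ H (s, 1) = p 1)].
Proof.
move=> [H [cH HX H0 H1 He]].
have c0 : clamp (0 : R) = 0 by rewrite clamp_id// lexx ler01.
have c1 : clamp (1 : R) = 1 by rewrite clamp_id// lexx ler01.
exists (fun st => H (clamp st.1, clamp st.2)); split.
- apply: (@within_retract _ _ _ _ H (fun st : R * R => (clamp st.1, clamp st.2)) cH).
    by cont.
  by move=> z; split; rewrite /= in_itv/= clamp_itv.
- move=> s t; apply: HX; exists (clamp s, clamp t) => //=.
  by split; rewrite /= in_itv/= clamp_itv.
- by move=> t t01 /=; rewrite c0 clamp_id// H0 // mem01.
- by move=> t t01 /=; rewrite c1 clamp_id// H1 // mem01.
- by move=> s; rewrite /= c0 c1; apply: He; rewrite mem01 clamp_itv.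
Qed.

Lemma homotopic_ends p q : path_homotopic X p q -> q 0 = p 0 /\ q 1 = p 1.
Proof.
move=> [H [_ _ H0 H1 He]].
have i0 : (0 : R) \in `[0, 1] by rewrite mem01 lexx ler01.
have i1 : (1 : R) \in `[0, 1] by rewrite mem01 lexx ler01.
by have [h1 h2] := He 1 i1; rewrite -!H1.
Qed.

Lemma homotopic_eq p p' q q' : (forall t, 0 <= t <= 1 -> p t = p' t) ->
  (forall t, 0 <= t <= 1 -> q t = q' t) ->
  path_homotopic X p q -> path_homotopic X p' q'.
Proof.
move=> pp qq [H [cH HX H0 H1 He]]; exists H; split=> // [t|t|s].
- by move=> t01; rewrite H0//; apply: pp; rewrite mem01 in t01.
- by move=> t01; rewrite H1//; apply: qq; rewrite mem01 in t01.
- by move=> /He[-> ->]; rewrite !pp ?lexx ?ler01.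
Qed.

Lemma homotopic_sym p q : path_homotopic X p q -> path_homotopic X q p.
Proof.
move=> pq; have [q0 q1] := homotopic_ends pq.
have [H [cH HX H0 H1 He]] := homotopicE pq.
apply: (@homotopicI _ _ (fun st => H (1 - st.1, st.2))).
- by apply: cont_comp cH; cont.
- by move=> s t _ _; exact: HX.
- by move=> t t01 /=; rewrite subr0; exact: H1.
- by move=> t t01 /=; rewrite subrr; exact: H0.
- by move=> s _ /=; rewrite q0 q1.
Qed.

Lemma homotopic_trans p q r : path_homotopic X p q -> path_homotopic X q r ->
  path_homotopic X p r.
Proof.
move=> pq qr; have [q0 q1] := homotopic_ends pq.
have [H [cH HX H0 H1 He]] := homotopicE pq.
have [K [cK KX K0 K1 Ke]] := homotopicE qr.
pose H' st := H (2 * st.1, clamp st.2); pose K' st := K (2 * st.1 - 1, clamp st.2).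
have i2 : (2 : R)^-1 * 2 = 1 by rewrite mulVf.
apply: (@homotopicI _ _ (fun st : R * R => if st.1 <= 2^-1 then H' st else K' st)).
- apply: (@pasting _ _ _ (fun st : R * R => st.1)); cont.
  + apply: (@cont_comp _ _ _ (fun st : R * R => (2 * st.1, clamp st.2)) H) cH; cont.
  + apply: (@cont_comp _ _ _ (fun st : R * R => (2 * st.1 - 1, clamp st.2)) K) cK; cont.
  + move=> [s t] /= ->; rewrite /H' /K' /= mulrC i2 subrr H1 ?K0 ?clamp_itv//.
- by move=> s t _ _; case: ifP => _; [exact: HX|exact: KX].
- move=> t t01; rewrite /= invr_ge0 ler0n /H' /= mulr0 clamp_id// H0 //.
- move=> t t01 /=; rewrite leNgt invf_lt1 ?ltr1n//= /K'/= clamp_id// mulr1.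
  by rewrite (_ : 2 - 1 = 1 :> R) ?K1//; lra.
- move=> s _; rewrite /H' /K' /= !clamp_id ?lexx ?ler01//.
  by case: ifP => _; [exact: He|have [-> ->] := Ke (2 * s - 1)].
Qed.

(** The straight-line homotopy between the two parameters stays in the unit interval. Associativity,
    units, inverses and subdivision below are all instances of it. *)
Lemma homotopic_reparam x y p (f g : R -> R) : path_in X x y p ->
  continuous f -> continuous g ->
  (forall t, 0 <= t <= 1 -> 0 <= f t <= 1) -> (forall t, 0 <= t <= 1 -> 0 <= g t <= 1) ->
  f 0 = g 0 -> f 1 = g 1 -> path_homotopic X (p \o f) (p \o g).
Proof.
move=> /path_inE[cp _ _ pX] cf cg f01 g01 fg0 fg1.
have cv s (a b : R) : 0 <= s <= 1 -> 0 <= a <= 1 -> 0 <= b <= 1 ->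
    0 <= (1 - s) * a + s * b <= 1 by move=> *; nra.
have [c0 c1] : clamp (0 : R) = 0 /\ clamp (1 : R) = 1.
  by split; rewrite clamp_id// lexx ler01.
apply: (@homotopicI _ _ (fun st => p (clamp ((1 - st.1) * f st.2 + st.1 * g st.2)))).
- apply: (cont_comp _ cp); cont; by apply: cont_comp; [cont|].
- by move=> s t s01 t01; apply/pX/clamp_itv.
- by move=> t t01 /=; rewrite subr0 mul1r mul0r addr0 clamp_id// f01.
- by move=> t t01 /=; rewrite subrr mul1r mul0r add0r clamp_id// g01.
- move=> s s01 /=; rewrite -fg0 -fg1 -!mulrDl subrK !mul1r.
  by rewrite !clamp_id// f01// lexx ler01.
Qed.

Lemma homotopic_refl x y p : path_in X x y p -> path_homotopic X p p.
Proof.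
by move=> h; apply: (@homotopic_reparam x y p id id h); cont.
Qed.

Lemma path_concat_continuous p q : continuous p -> continuous q -> p 1 = q 0 ->
  continuous (path_concat p q).
Proof.
move=> cp cq pq; apply: (@pasting _ _ _ (fun t : R => t)); cont.
- by apply: cont_comp cp; cont.
- by apply: cont_comp cq; cont.
- by move=> t ->; rewrite mulfV// subrr.
Qed.

Lemma path_concat_in x y z p q : path_in X x y p -> path_in X y z q ->
  path_in X x z (path_concat p q).
Proof.
move=> /path_inE[cp p0 p1 pX] /path_inE[cq q0 q1 qX].
have [c0 c1] : clamp (0 : R) = 0 /\ clamp (1 : R) = 1.
  by split; rewrite clamp_id// lexx ler01.
apply: (@path_inI _ _ _ (path_concat (fun t => p (clamp t)) (fun t => q (clamp t)))).
- by apply: path_concat_continuous => //; rewrite c0 c1 p1.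
- move=> t t01; rewrite /path_concat; case: ifPn => [h|].
    by rewrite clamp_id//; apply/andP; split; lra.
  by rewrite -ltNge => h; rewrite clamp_id//; apply/andP; split; lra.
- by rewrite /path_concat invr_ge0 ler0n mulr0.
- rewrite /path_concat leNgt invf_lt1 ?ltr1n//= mulr1.
  by rewrite (_ : 2 - 1 = 1 :> R)//; lra.
- move=> t t01; rewrite /path_concat; case: ifPn => [h|].
    by apply: pX; apply/andP; split; lra.
  by rewrite -ltNge => h; apply: qX; apply/andP; split; lra.
Qed.

Lemma path_rev_in x y p : path_in X x y p -> path_in X y x (path_rev p).
Proof.
move=> /path_inE[cp p0 p1 pX].
apply: (@path_inI _ _ _ (fun t => p (clamp (1 - t)))).
- by apply: (@cont_comp _ _ _ (fun t : R => 1 - t)) cp; cont.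
- by move=> t t01; rewrite /path_rev clamp_id//; lra.
- by rewrite /path_rev subr0.
- by rewrite /path_rev subrr.
- by move=> t t01; apply: pX; lra.
Qed.

Lemma path_cst_in x : X x -> path_in X x x (cst x : R -> T).
Proof. by move=> Xx; apply: (@path_inI _ _ _ (cst x : R -> T)) => // y; exact: cvg_cst. Qed.

Lemma homotopic_concat p p' q q' : path_homotopic X p p' -> path_homotopic X q q' ->
  p 1 = q 0 -> path_homotopic X (path_concat p q) (path_concat p' q').
Proof.
move=> pp qq pq.
have [H [cH HX H0 H1 He]] := homotopicE pp.
have [K [cK KX K0 K1 Ke]] := homotopicE qq.
pose H' st := H (st.1, 2 * st.2); pose K' st := K (st.1, 2 * st.2 - 1).
apply: (@homotopicI _ _ (fun st : R * R => if st.2 <= 2^-1 then H' st else K' st)).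
- apply: (@pasting _ _ _ (fun st : R * R => st.2)); cont.
  + by apply: (@cont_comp _ _ _ (fun st : R * R => (st.1, 2 * st.2)) H) cH; cont.
  + by apply: (@cont_comp _ _ _ (fun st : R * R => (st.1, 2 * st.2 - 1)) K) cK; cont.
  + move=> [s t] /= ->; rewrite /H' /K' /= mulfV// subrr.
    by rewrite (He s).2 (Ke s).1.
- by move=> s t _ _; case: ifP => _; [exact: HX|exact: KX].
- move=> t t01; rewrite /path_concat /H' /K' /=; case: ifPn => [h|].
    by rewrite H0//; lra.
  by rewrite -ltNge => h; rewrite K0//; lra.
- move=> t t01; rewrite /path_concat /H' /K' /=; case: ifPn => [h|].
    by rewrite H1//; lra.
  by rewrite -ltNge => h; rewrite K1//; lra.
- move=> s _; rewrite /path_concat /H' /K' /= invr_ge0 ler0n mulr0 (He s).1; split=> //.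
  rewrite leNgt invf_lt1 ?ltr1n//= mulr1 (_ : 2 - 1 = 1 :> R) ?(Ke s).2//; lra.
Qed.

Lemma homotopic_assoc x y z w p q r :
  path_in X x y p -> path_in X y z q -> path_in X z w r ->
  path_homotopic X (path_concat (path_concat p q) r) (path_concat p (path_concat q r)).
Proof.
move=> hp hq hr; have h := path_concat_in hp (path_concat_in hq hr).
(* The change of parameter has slopes 2, 1 and 1/2 on [0, 1/4], [1/4, 1/2] and [1/2, 1]; being
   concave, it is the minimum of its three affine pieces. *)
apply: (homotopic_eq _ _ (@homotopic_reparam _ _ _
  (fun t => Num.min (Num.min (2 * t) (t + 4^-1)) (2^-1 * (t + 1))) id h _ _ _ _ _ _)) => //.
- move=> t t01; rewrite /path_concat /=.
  have [h1|h1] := leP t 2^-1.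
    rewrite (_ : Num.min _ (2^-1 * (t + 1)) = Num.min (2 * t) (t + 4^-1)); last first.
      by apply/min_idPl; rewrite ge_min; apply/orP; right; lra.
    have [h2|h2] := leP (2 * t) 2^-1.
      by rewrite (min_idPl _) ?h2//; lra.
    rewrite (min_idPr _); last lra.
    have [h3|h3] := leP (t + 4^-1) 2^-1; first by exfalso; lra.
    rewrite (_ : 2 * (t + 4^-1) - 1 <= 2^-1); last lra.
    by congr q; lra.
  rewrite (min_idPr _); last by rewrite le_min; apply/andP; split; lra.
  rewrite leNgt (_ : 2^-1 < 2^-1 * (t + 1)) /=; last lra.
  have [h3|h3] := leP (2 * (2^-1 * (t + 1)) - 1) 2^-1; first by exfalso; lra.
  by congr r; lra.
- by cont.
- by cont.
- move=> t t01; rewrite !le_min !ge_min; apply/andP; split;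
    first (apply/andP; split; [apply/andP; split|]; lra).
  by apply/orP; right; lra.
- by rewrite mulr0 (min_idPl _) ?(min_idPl _)//; lra.
- rewrite (min_idPr _) ; first lra.
  by rewrite le_min; apply/andP; split; lra.
Qed.

Lemma homotopic_idr x y p : path_in X x y p ->
  path_homotopic X (path_concat p (cst y)) p.
Proof.
move=> h; have [_ p0 p1 _] := path_inE h.
apply: (homotopic_eq _ _ (@homotopic_reparam _ _ _ (fun t => Num.min (2 * t) 1) id h _ _ _ _ _ _)) => //.
- move=> t t01; rewrite /path_concat /=; have [h1|h1] := leP t 2^-1.
    by rewrite (min_idPl _)//; lra.
  by rewrite (min_idPr _)//; lra.
- by cont.
- by cont.
- by move=> t t01; rewrite le_min ge_min lexx orbT andbT; apply/andP; split; lra.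
- by rewrite mulr0 (min_idPl _).
- by rewrite (min_idPr _)//; lra.
Qed.

Lemma homotopic_idl x y p : path_in X x y p ->
  path_homotopic X (path_concat (cst x) p) p.
Proof.
move=> h; have [_ p0 p1 _] := path_inE h.
apply: (homotopic_eq _ _ (@homotopic_reparam _ _ _ (fun t => Num.max (2 * t - 1) 0) id h _ _ _ _ _ _)) => //.
- move=> t t01; rewrite /path_concat /=; have [h1|h1] := leP t 2^-1.
    by rewrite (max_idPr _)//; lra.
  by rewrite (max_idPl _)//; lra.
- by cont.
- by cont.
- by move=> t t01; rewrite ge_max le_max lexx orbT /=; apply/andP; split; lra.
- by rewrite mulr0 (max_idPr _) //; lra.
- by rewrite (max_idPl _)//; lra.
Qed.

Lemma homotopic_invr x y p : path_in X x y p ->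
  path_homotopic X (path_concat p (path_rev p)) (cst x).
Proof.
move=> h; have [_ p0 p1 _] := path_inE h.
apply: (homotopic_eq _ _ (@homotopic_reparam _ _ _
  (fun t => Num.min (2 * t) (2 - 2 * t)) (cst 0) h _ _ _ _ _ _)) => //.
- move=> t t01; rewrite /path_concat /path_rev /=; have [h1|h1] := leP t 2^-1.
    by rewrite (min_idPl _)//; lra.
  by rewrite (min_idPr _); [congr p|]; lra.
- by cont.
- by cont.
- by move=> t t01; rewrite le_min ge_min; apply/andP; split;
    [apply/andP; split|apply/orP; case: (leP t 2^-1) => ?; [left|right]]; lra.
- by move=> t _; rewrite lexx ler01.
- by rewrite mulr0 (min_idPl _)//; lra.
- by rewrite (min_idPr _)//=; lra.
Qed.

(** This is what lets an argument advance along a path from parameter [a] to parameter [b]. *)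
Lemma homotopic_split x y p a b : path_in X x y p -> 0 <= a -> a <= b -> b <= 1 ->
  path_homotopic X (fun t => p (b * t))
    (path_concat (fun t => p (a * t)) (fun t => p (a + (b - a) * t))).
Proof.
move=> h a0 ab b1.
apply: (homotopic_eq _ _ (@homotopic_reparam _ _ _ (fun t => b * t)
  (fun t => a * Num.min (2 * t) 1 + (b - a) * Num.max 0 (2 * t - 1)) h _ _ _ _ _ _)) => //.
- move=> t t01; rewrite /path_concat /=; have [h1|h1] := leP t 2^-1.
    by rewrite (min_idPl _) ?(max_idPl _); [rewrite mulr0 addr0|lra..].
  by rewrite (min_idPr _) ?(max_idPr _); [rewrite mulr1|lra..].
- by cont.
- by cont.
- by move=> t t01; nra.
- move=> t t01; have [h1|h1] := leP t 2^-1.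
    by rewrite (min_idPl _) ?(max_idPl _); nra.
  by rewrite (min_idPr _) ?(max_idPr _); nra.
- by rewrite !mulr0 (min_idPl _) ?(max_idPl _); lra.
- by rewrite !mulr1 (min_idPr _) ?(max_idPr _); lra.
Qed.

End Homotopy.

(** * Sets not covered by short intervals *)


Section Fat.
Variable R : realType.
Local Notation mu := (@lebesgue_measure R).

(* [E] is not covered by any [n] intervals of length comparable to [1/n]. *)
Definition fat (E : set R) := exists2 A, 0 < A & forall s : seq R,
  exists2 y, E y & forall u, u \in s -> A / (size s).+1%:R <= `|y - u|.

Definition thicken (s : seq R) (r : R) : set R := \big[setU/set0]_(u <- s) (ball u r).

Lemma measurable_thicken s r : measurable (thicken s r).
Proof. by apply: bigsetU_measurable => u _; by rewrite ball_itv; exact: measurable_itv. Qed.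

Lemma thickenP s r y : thicken s r y <-> exists2 u, u \in s & `|y - u| < r.
Proof.
rewrite /thicken; elim: s => [|u s IH].
  by rewrite big_nil; split=> // -[].
rewrite big_cons; split.
  move=> [/= h|/IH[v vs hv]].
    by exists u; rewrite ?mem_head// distrC.
  by exists v; rewrite // inE vs orbT.
move=> [v]; rewrite inE => /orP[/eqP ->|vs] hv.
  by left; rewrite /= /ball/= distrC.
by right; apply/IH; exists v.
Qed.

Lemma measure_thicken s (r : R) : 0 <= r ->
  (mu (thicken s r) <= ((size s)%:R * (r *+ 2))%:E)%E.
Proof.
move=> r0; rewrite /thicken; elim: s => [|u s IH].
  by rewrite big_nil measure0 mul0r.
rewrite big_cons /=; apply: (le_trans (measureU2 _ _ _)).
- by rewrite ball_itv; exact: measurable_itv.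
- exact: measurable_thicken.
rewrite -[(size s).+1]add1n natrD mulrDl mul1r EFinD; apply: leeD => //.
by rewrite -(lebesgue_measure_ball u r0).
Qed.

(** If no [E m] were fat, each would be covered by finitely many balls of small total length, and
    countable subadditivity would make the interval too short. Only the covers are measured, so the
    [E m] need not be measurable. *)
Lemma fat_cover (E : nat -> set R) (a b : R) : a < b ->
  `]a, b[ `<=` \bigcup_m E m -> exists m, fat (E m).
Proof.
move=> ab abE; apply: contrapT => /forallNP nE.
(* The cover of [E m] will have measure at most [2 * r m], that is [e / 2 ^ m.+1]. These sum to at
   most [e], half the length of the interval. *)
pose e := (b - a) / 2; have e0 : 0 < e by rewrite divr_gt0// subr_gt0.
pose r m := e / 2 / (2 ^ m.+1)%:R.
have r0 m : 0 < r m by apply: divr_gt0; [exact: divr_gt0|rewrite ltr0n expn_gt0].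
have H m : exists s : seq R, E m `<=` thicken s (r m / (size s).+1%:R).
  apply: contrapT => /forallNP ns; apply: (nE m); exists (r m) => // s.
  have /existsNP[y /not_implyP[Ey ny]] := ns s.
  exists y => // u us; rewrite leNgt; apply/negP => yu; apply: ny.
  by apply/thickenP; exists u.
have [s sE] := choice H.
pose F m := thicken (s m) (r m / (size (s m)).+1%:R).
have : (mu `]a, b[ <= \sum_(0 <= m <oo) mu (F m))%E.
  apply: measure_sigma_subadditive => //.
  - by move=> m; exact: measurable_thicken.
  - by move=> y /abE[m _ Emy]; exists m => //; exact: sE.
rewrite lebesgue_measure_itv/= lte_fin ab -EFinD => h.
have : ((b - a)%:E <= e%:E)%E.
  apply: (le_trans h); apply: (le_trans _ (epsilon_trick0 xpredT (ltW e0))).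
  apply: lee_nneseries => m _; first by move=> ?; apply: measure_ge0.
  apply: (le_trans (measure_thicken _ _)).
    by rewrite divr_ge0// ltW.
  rewrite lee_fin -mulrnAl mulrCA -[leRHS]mulr1.
  have -> : e / (2 ^ m.+1)%:R = r m *+ 2.
    have lem (x y : R) : x * y = x / 2 * y *+ 2 by rewrite mulr2n; lra.
    exact: lem.
  apply: ler_pM => //; first by rewrite mulrn_wge0// ltW.
  by rewrite ler_pdivrMr// mul1r ler_nat.
rewrite lee_fin /e; lra.
Qed.

Lemma fat_itv (a b : R) : a < b -> fat `]a, b[.
Proof.
move=> ab; have [|m//] := @fat_cover (fun=> `]a, b[) a b ab.
by move=> y yab; exists 0%N.
Qed.
End Fat.

(** * Differentiability in Caratheodory's form *)


Section PointwiseContinuity.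
Variables (K : numFieldType) (X : topologicalType).
Implicit Types (f g : X -> K) (x : X).

Lemma at_contD f g x : {for x, continuous f} -> {for x, continuous g} ->
  {for x, continuous (fun y => f y + g y)}.
Proof. by move=> cf cg; exact: cvgD. Qed.
Lemma at_contB f g x : {for x, continuous f} -> {for x, continuous g} ->
  {for x, continuous (fun y => f y - g y)}.
Proof. by move=> cf cg; exact: cvgB. Qed.
Lemma at_contM f g x : {for x, continuous f} -> {for x, continuous g} ->
  {for x, continuous (fun y => f y * g y)}.
Proof. by move=> cf cg; exact: cvgM. Qed.
Lemma at_contK a x : {for x, continuous (fun _ : X => a : K)}.
Proof. exact: cst_continuous. Qed.
End PointwiseContinuity.

Lemma at_cont_comp (X Y Z : topologicalType) (f : X -> Y) (g : Y -> Z) x :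
  {for x, continuous f} -> {for f x, continuous g} ->
  {for x, continuous (fun y => g (f y))}.
Proof. by move=> cf cg; exact: continuous_comp. Qed.

Lemma near_eq_continuous (X Y : topologicalType) (f g : X -> Y) x :
  (\forall y \near x, f y = g y) -> {for x, continuous f} -> {for x, continuous g}.
Proof.
move=> fg cf U gU; change (nbhs x (g @^-1` U)).
have fU : nbhs (f x) U by rewrite (nbhs_singleton fg).
have h : nbhs x (f @^-1` U) := cf U fU.
by apply: filterS2 fg h => y /= ->.
Qed.

Section Caratheodory.
Variable K : numFieldType.
Implicit Types (f : K -> K) (z D : K).

(* In this form composition is immediate, also along real paths in [C]. *)
Definition has_deriv f z D := exists q : K -> K,
  [/\ {for z, continuous q}, q z = D & forall w, f w - f z = q w * (w - z)].

Lemma derivable_has_deriv f z : derivable f z 1 -> has_deriv f z (derive1 f z).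
Proof.
move=> fz; set D := derive1 f z.
have fD : (h^-1 *: (f (h + z) - f z)) @[h --> 0^'] --> D.
  rewrite /D derive1E; move: fz; rewrite /derivable/derive.
  set g := (fun h : K => _) => cg.
  rewrite (_ : (fun h : K => _) = g); first exact: cg.
  by apply/funext => h; rewrite /g /= [h%:A](mulr1).
exists (fun w => if w == z then D else (f w - f z) / (w - z)); split.
- apply/(@cvgrPdist_lt _ _ _ (nbhs z) (nbhs_filter z)) => e e0; rewrite eqxx.
  have h : nbhs (0 : K) [set h : K | h != 0 -> `|D - h^-1 *: (f (h + z) - f z)| < e].
    exact: (cvgrPdist_lt _ _).1 fD e e0.
  have /nbhs_normP[d d0 dB] := h.
  apply/nbhs_normP; exists d => // w /= zw; case: eqP => [|/eqP] wz; first by rewrite subrr normr0.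
  have := dB (w - z); rewrite /= sub0r normrN distrC zw subr_eq0 => /(_ isT wz).
  by rewrite subrK /GRing.scale/= mulrC.
- by rewrite eqxx.
- move=> w; case: eqP => [->|/eqP wz]; first by rewrite !subrr mulr0.
  by rewrite divfK// subr_eq0.
Qed.

Lemma has_derivP f z D : has_deriv f z D -> derivable f z 1 /\ derive1 f z = D.
Proof.
move=> [q [cq <- fq]].
suff h : (h^-1 *: (f (h + z) - f z)) @[h --> 0^'] --> q z.
  split; last by apply: cvg_lim => //; exact: norm_hausdorff.
  apply/cvg_ex; exists (q z).
  move: h; set g := (fun h : K => _) => cg.
  rewrite (_ : (fun h : K => _) = g); first exact: cg.
  by apply/funext => h; rewrite /g /= [h%:A](mulr1).
apply/cvgrPdist_lt => e e0.
change (nbhs (0 : K) [set h : K | h != 0 -> `|q z - h^-1 *: (f (h + z) - f z)| < e]).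
have /nbhs_normP[d d0 dB] := (@cvgrPdist_lt _ _ _ (nbhs z) (nbhs_filter z) _ _).1 cq e e0.
apply/nbhs_normP; exists d => // h /=; rewrite sub0r normrN => hd h0.
rewrite fq addrK /GRing.scale/= mulrC mulfK//.
by apply: dB => /=; rewrite distrC addrK.
Qed.

Lemma has_deriv_comp f g z D E : has_deriv f z D -> has_deriv g (f z) E ->
  has_deriv (g \o f) z (E * D).
Proof.
move=> [q [cq qD fq]] [r [cr rE gr]].
exists (fun w => r (f w) * q w); split; last 2 first.
- by rewrite rE qD.
- by move=> w; rewrite /= gr fq mulrA.
have cf : {for z, continuous f}.
  have -> : f = (fun w => q w * (w - z) + f z).
    by apply/funext => w; rewrite -fq subrK.
  apply: at_contD; last exact: at_contK.
  by apply: at_contM => //; apply: at_contB; [exact: cvg_id|exact: at_contK].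
apply: at_contM => //; exact: (@continuous_comp _ _ _ f r).
Qed.

Lemma has_derivB f g z D E : has_deriv f z D -> has_deriv g z E ->
  has_deriv (fun w => f w - g w) z (D - E).
Proof.
move=> [q [cq qD fq]] [r [cr rE gr]].
exists (fun w => q w - r w); split; first exact: at_contB.
  by rewrite qD rE.
by move=> w; rewrite mulrBl -fq -gr opprB addrACA opprB [_ - f z]addrC addrACA addrCA addrA.
Qed.

Lemma has_deriv_affine (a b z : K) : has_deriv (fun w => a + b * w) z b.
Proof.
exists (fun=> b); split=> //; first exact: cst_continuous.
by move=> w; rewrite opprD addrACA subrr add0r -mulrBr.
Qed.

Lemma has_deriv_near f g z D : (\forall w \near z, f w = g w) ->
  has_deriv f z D -> has_deriv g z D.
Proof.
move=> fg /has_derivP[df <-].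
have -> : derive1 f z = derive1 g z by rewrite !derive1E; exact: near_eq_derive.
apply: derivable_has_deriv; exact: near_eq_derivable df.
Qed.
End Caratheodory.

Section AlongPath.
Variable R : realType.
Local Notation C := (Cplx R).

(** The slope of [phi], taken along [z] and multiplied out into real and imaginary parts, yields the
    two real slopes. *)
Lemma has_deriv_along (phi : C -> C) (z : R -> C) (t : R) (D v : C) :
  has_deriv phi (z t) D ->
  has_deriv (fun u => ReC (z u)) t (ReC v) -> has_deriv (fun u => ImC (z u)) t (ImC v) ->
  has_deriv (fun u => ReC (phi (z u))) t (ReC (D * v)) /\
  has_deriv (fun u => ImC (phi (z u))) t (ImC (D * v)).
Proof.
move=> [q [cq qD fq]] [qa [ca av za]] [qb [cb bv zb]].
have cR (g qg : R -> R) : {for t, continuous qg} ->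
    (forall w, g w - g t = qg w * (w - t)) -> {for t, continuous g}.
  move=> cg gE.
  have -> : g = (fun w => qg w * (w - t) + g t).
    by apply/funext => w; rewrite -gE subrK.
  apply: at_contD; last exact: at_contK.
  by apply: at_contM => //; apply: at_contB; [exact: cvg_id|exact: at_contK].
have cz : {for t, continuous z}.
  by apply: continuousC_pair; [exact: cR ca za|exact: cR cb zb].
have cqz : {for t, continuous (fun u => q (z u))} by apply: at_cont_comp cz cq.
have cRq : {for t, continuous (fun u => ReC (q (z u)))}.
  by apply: at_cont_comp cqz _; exact: continuous_ReC.
have cIq : {for t, continuous (fun u => ImC (q (z u)))}.
  by apply: at_cont_comp cqz _; exact: continuous_ImC.
split.
- exists (fun u => ReC (q (z u)) * qa u - ImC (q (z u)) * qb u); split.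
  + by apply: at_contB; apply: at_contM.
  + by rewrite qD av bv ReCM.
  + move=> w; have := congr1 (@ReC R) (fq (z w)).
    by rewrite !ReImC za zb => ->; ring.
- exists (fun u => ReC (q (z u)) * qb u + ImC (q (z u)) * qa u); split.
  + by apply: at_contD; apply: at_contM.
  + by rewrite qD av bv ImCM.
  + move=> w; have := congr1 (@ImC R) (fq (z w)).
    by rewrite !ReImC za zb => ->; ring.
Qed.
End AlongPath.

(** * Integrals of possibly non-measurable functions *)


Section Integrals.
Variable R : realType.
Local Notation mu := (@lebesgue_measure R).

(* The functions need not be measurable: the integral of a nonnegative function
   is a supremum over the simple functions below it. *)
Lemma ge0_le_integral_subset (A D : set R) (f g : R -> \bar R) : A `<=` D ->
  (forall x, D x -> 0 <= g x)%E -> (forall x, A x -> 0 <= f x <= g x)%E ->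
  (\int[mu]_(x in A) f x <= \int[mu]_(x in D) g x)%E.
Proof.
move=> AD g0 fg.
have f0 x : A x -> (0 <= f x)%E by move=> /fg/andP[].
rewrite (ge0_integralE lebesgue_measure f0) (ge0_integralE lebesgue_measure g0).
apply: le_ereal_sup => _ [h hf <-]; exists h => // x.
apply: (le_trans (hf x)); rewrite !patchE; case: ifPn => [|xA].
  rewrite inE => xA; have -> : x \in D by rewrite inE; exact: AD.
  by case/andP: (fg x xA).
by case: ifPn => //; rewrite inE => /g0.
Qed.

Lemma finite_seq_null (N : seq R) : mu [set` N] = 0%E.
Proof. by apply: countable_lebesgue_measure0; exact/finite_set_countable/finite_seq. Qed.

(** The Kobayashi integrand is not known to be measurable and is uncontrolled at breakpoints. It is
    dominated by a measurable function equal to [+oo] on the null set [N] and to [M] elsewhere. *)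
Lemma integral01_le (f : R -> \bar R) (M : R) (N : seq R) :
  (forall t, 0 <= f t)%E -> 0 <= M ->
  (forall t, 0 <= t <= 1 -> t \notin N -> (f t <= M%:E)%E) ->
  (\int[mu]_(t in `[0%R, 1%R]) f t <= M%:E)%E.
Proof.
move=> f0 M0 fM.
pose g t : \bar R := if t \in N then +oo%E else M%:E.
have g0 t : (0 <= g t)%E by rewrite /g; case: ifP.
have mN : measurable [set` N] by apply: countable_measurable => //; exact/finite_set_countable/finite_seq.
have gE : (\int[mu]_(t in `[0%R, 1%R]) g t = \int[mu]_(t in `[0%R, 1%R]) M%:E)%E.
  apply: ge0_ae_eq_integral => //.
  - have mb : measurable_fun setT (fun t : R => t \in N).
      apply: (@measurable_fun_bool _ _ _ _ true); rewrite setTI.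
      exact: mN.
    by apply: measurable_funTS; exact: measurable_fun_ifT.
  - exists [set` N]; split => //; first exact: finite_seq_null.
    by move=> t /= /not_implyP[_]; rewrite /g; case: ifP.
apply: (@le_trans _ _ (\int[mu]_(t in `[0%R, 1%R]) g t)%E).
  apply: ge0_le_integral_subset => // t; rewrite /= in_itv/= => t01.
  rewrite f0 /g; case: ifPn => // tN; first by rewrite leey.
  exact: fM.
rewrite gE integral_cst//= lebesgue_measure_itv/= lte_fin ltr01 -EFinD subr0.
by rewrite -EFinM mulr1.
Qed.

(** Induction on the number of exceptional points: the interval is cut at one of them, which then
    drops out of the list for both halves. *)
Lemma nondecreasing_except (g : R -> R) (a b : R) (N : seq R) : a <= b ->
  {within `[a, b], continuous g} ->
  (forall t, a < t < b -> t \notin N -> derivable g t 1 /\ 0 <= derive1 g t) ->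
  g a <= g b.
Proof.
move: a b; have [n] := ubnP (size N); elim: n N => // n IH N sN a b ab cg dg.
have [[c /andP[cN cab]]|nc] := pselect (exists c, (c \in N) && (a < c < b)).
  have /andP[ac cb] := cab.
  have lt : (size (seq.filter (predC1 c) N) < n)%N.
    rewrite -ltnS; apply: leq_trans sN; rewrite ltnS -(count_predC (pred1 c) N) size_filter.
    by rewrite -[X in (X < _)%N]add0n ltn_add2r -has_count has_pred1.
  apply: (@le_trans _ _ (g c)).
    apply: (IH _ lt _ _ (ltW ac)).
      apply: continuous_subspaceW cg => x /=; rewrite !in_itv/= => /andP[-> xc] /=.
      exact: le_trans xc (ltW cb).
    move=> t /andP[at_ tc]; rewrite mem_filter negb_and /= negbK (lt_eqF tc)/= => tN.
    by apply: dg => //; rewrite at_ (lt_trans tc).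
  apply: (IH _ lt _ _ (ltW cb)).
    apply: continuous_subspaceW cg => x /=; rewrite !in_itv/= => /andP[xc ->].
    by rewrite andbT (le_trans (ltW ac)).
  move=> t /andP[ct tb]; rewrite mem_filter negb_and /= negbK (gt_eqF ct)/= => tN.
  by apply: dg => //; rewrite tb (lt_trans ac).
have nN t : a < t < b -> t \notin N.
  by move=> tab; apply/negP => tN; apply: nc; exists t; rewrite tN.
apply: (@ger0_derive1_le_cc R g a b) => //; rewrite ?in_itv/= ?lexx ?ab//.
- by move=> t; rewrite in_itv/= => tab; apply: (dg t tab (nN t tab)).1.
- by move=> t; rewrite in_itv/= => tab; apply: (dg t tab (nN t tab)).2.
Qed.

(** The function [F] is replaced by [G], equal to [F] on the open set [U] where [F] is known to be
    continuous and zero elsewhere; this makes it measurable without raising it. If the integral of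
    [G] is finite, its primitive [Phi] satisfies [Phi' = F] on [U], so [Phi - h] is
    nondecreasing. *)
Lemma le_integral_increment (F h : R -> R) (a b : R) (N : seq R) :
  a <= b -> 0 <= a -> b <= 1 -> (forall t, 0 <= F t) ->
  {within `[a, b], continuous h} ->
  (forall t, a < t < b -> t \notin N ->
    {for t, continuous F} /\ exists2 h', has_deriv h t h' & h' <= F t) ->
  ((h b - h a)%:E <= \int[mu]_(t in `[0%R, 1%R]) (F t)%:E)%E.
Proof.
move=> ab a0 b1 F0 ch dh.
pose U := `]a, b[%classic `\` [set` N].
have UP t : U t <-> a < t < b /\ t \notin N.
  rewrite /U /setD/= in_itv/=; split=> -[tab /negP tN]; split=> //; exact/negP.
pose G t := if t \in U then F t else 0.
have G0 t : 0 <= G t by rewrite /G; case: ifP.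
have openU : open U.
  apply: openI; first exact: interval_open.
  apply: closed_openC; apply: compact_closed; first exact: order_hausdorff.
  exact/finite_compact/finite_seq.
have cG t : U t -> {for t, continuous G} /\ G t = F t.
  move=> Ut; have /UP[tab tN] := Ut.
  have [cF _] := dh t tab tN.
  have GF : \forall u \near t, G u = F u.
    have : nbhs t U by exact: open_nbhs_nbhs.
    by apply: filterS => u Uu; rewrite /G mem_set.
  have GFt := nbhs_singleton GF; split=> //.
  by apply: near_eq_continuous cF; apply: filterS GF => u ->.
have mU : measurable U by exact: open_measurable.
have mG : measurable_fun setT G.
  have mb : measurable_fun setT (fun t : R => t \in U).
    apply: (@measurable_fun_bool _ _ _ _ true); rewrite setTI.
    rewrite (_ : _ @^-1` _ = U)//; apply/seteqP; split=> t /=; first by move/set_mem.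
    exact: mem_set.
  apply: measurable_fun_if => //.
  rewrite setTI (_ : _ @^-1` _ = U); last first.
    by apply/seteqP; split=> t /=; [move/set_mem|exact: mem_set].
  apply: open_continuous_measurable_fun => // t; rewrite inE => /UP[tab tN].
  by have [] := dh t tab tN.
have le1 : (\int[mu]_(t in `[a, b]) (G t)%:E <= \int[mu]_(t in `[0%R, 1%R]) (F t)%:E)%E.
  apply: ge0_le_integral_subset => //.
  - by move=> t /=; rewrite !in_itv/= => /andP[at_ tb]; rewrite (le_trans a0)// (le_trans tb).
  - by move=> t _; rewrite lee_fin.
  - by move=> t _; rewrite !lee_fin G0/= /G; case: ifP.
apply: le_trans le1.
have [fin|] := ltP (\int[mu]_(t in `[a, b]) (G t)%:E)%E +oo%E; last first.
  by rewrite leye_eq => /eqP ->; rewrite leey.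
have iG : mu.-integrable `[a, b] (EFin \o G).
  apply/integrableP; split.
    apply/measurable_EFinP; exact: measurable_funTS.
  by under eq_integral do rewrite /= ger0_norm//.
pose Phi t := parameterized_integral mu a t G.
have cPhi := parameterized_integral_continuous ab iG.
have dPhi t : a < t < b -> t \notin N -> derivable Phi t 1 /\ derive1 Phi t = F t.
  move=> tab tN; have /cG[cGt <-] : U t by apply/UP.
  have /andP[at_ tb] := tab.
  exact: (@continuous_FTC1_closed R G a t b tb iG).
have : Phi a - h a <= Phi b - h b.
  apply: (@nondecreasing_except (fun t => Phi t - h t) a b N ab).
    by move=> t; apply: at_contB; [exact: cPhi|exact: ch].
  move=> t tab tN; have [dP PF] := dPhi t tab tN.
  have [_ [h' dh' h'F]] := dh t tab tN.
  have /has_derivP[? ->] : has_deriv (fun t => Phi t - h t) t (F t - h').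
    by apply: has_derivB dh'; rewrite -PF; exact: derivable_has_deriv.
  by split; rewrite // subr_ge0.
have -> : Phi a = 0.
  by rewrite /Phi /parameterized_integral set_itv1 Rintegral_set1.
rewrite sub0r -subr_ge0 opprK => hab.
have -> : (\int[mu]_(t in `[a, b]) (G t)%:E)%E = (Phi b)%:E.
  rewrite /Phi /parameterized_integral /Rintegral fineK// ge0_fin_numE//.
  by apply: integral_ge0 => t _; rewrite lee_fin.
by rewrite lee_fin; clear -hab; lra.
Qed.
End Integrals.

(** * Velocities and the Kobayashi metric in charts *)


Section Charts.
Variables (R : realType) (T : topologicalType) (B : riemann_surface R T).
Local Notation C := (Cplx R).
Implicit Types (c : chart R T) (p : R -> T) (x y : T) (z w v : C) (X : set T).

(** Unlike [velocity], which is total, this asserts that the derivatives exist. *)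
Definition chart_deriv c p (t : R) v :=
  has_deriv (fun u => ReC (cmap c (p u))) t (ReC v) /\
  has_deriv (fun u => ImC (cmap c (p u))) t (ImC v).

Lemma velocityE c p t v : chart_deriv c p t v -> velocity c p t = v.
Proof.
move=> [/has_derivP[_ hr] /has_derivP[_ hi]].
exact: (@C_ext R (velocity c p t) v hr hi).
Qed.

Definition transition c c' x : C := derive1 (cmap c' \o cinv c) (cmap c x).

Lemma transition_deriv c c' x : atlas B c -> atlas B c' -> cdom c x -> cdom c' x ->
  has_deriv (cmap c' \o cinv c) (cmap c x) (transition c c' x).
Proof.
by move=> Bc Bc' cx cx'; apply: derivable_has_deriv; exact: (atlas_holomorphic Bc Bc').
Qed.

Lemma chart_deriv_change c c' p t v : atlas B c -> atlas B c' ->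
  (\forall u \near t, cdom c (p u)) -> cdom c' (p t) ->
  chart_deriv c p t v -> chart_deriv c' p t (transition c c' (p t) * v).
Proof.
move=> Bc Bc' cp cpt' [hr hi].
have cpt := nbhs_singleton cp.
have [hr' hi'] := has_deriv_along (z := fun u => cmap c (p u)) (transition_deriv Bc Bc' cpt cpt') hr hi.
split; [apply: has_deriv_near hr'|apply: has_deriv_near hi'].
  by apply: filterS cp => u cpu /=; rewrite cmapK.
by apply: filterS cp => u cpu /=; rewrite cmapK.
Qed.

Definition sq z (e : R) : set C :=
  [set w | `|ReC w - ReC z| < e /\ `|ImC w - ImC z| < e].

Lemma sqW z e e' : e <= e' -> sq z e `<=` sq z e'.
Proof. by move=> ee w [wr wi]; split; exact: lt_le_trans ee. Qed.

Lemma sq_center z e : 0 < e -> sq z e z.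
Proof. by move=> e0; split; rewrite subrr normr0. Qed.

Lemma kobayashi_ge0 X c x v : (0 <= kobayashi B X c x v)%E.
Proof.
apply: le_ereal_inf_tmp => _ [rho [rho0 _] <-].
by rewrite lee_fin divr_ge0// ltW.
Qed.

(** The competing disc is affine in the chart [c]: the map [s |-> cmap c x + w * s] sends the disc
    of radius [e / W] into the square of half-side [e]. The chart [c'] only serves to express the
    tangent vector. *)
Lemma kobayashi_le X c c' x w (e W : R) : atlas B c -> atlas B c' ->
  cdom c x -> cdom c' x -> 0 < e -> 0 < W -> `|w| <= (W%:C)%C ->
  sq (cmap c x) e `<=` cmap c @` (cdom c `&` X) ->
  (kobayashi B X c' x (transition c c' x * w) <= (2 * W / e)%:E)%E.
Proof.
move=> Bc Bc' cx cx' e0 W0 wW sqX.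
pose aff (s : C) : C := cmap c x + w * s.
have affP (s : C) : `|s| < ((e / W)%:C)%C -> sq (cmap c x) e (aff s).
  move=> se.
  have : `|w * s| < (e%:C)%C.
    rewrite normrM; apply: le_lt_trans (_ : (W%:C)%C * `|s| < _); first exact: ler_wpM2r.
    rewrite -ltr_pdivlMl; last by rewrite ltcR.
    by rewrite mulrC -fmorphV -rmorphM.
  rewrite normC_ltE => h; rewrite /sq /= /aff !ReImC.
  by split; rewrite addrAC subrr add0r -?ReCM -?ImCM; apply: le_lt_trans h; rewrite ?ReC_le_sqrt ?ImC_le_sqrt.
apply: ereal_inf_lbound; exists (e / W); last first.
  by rewrite invf_div mulrA.
split; first by rewrite divr_gt0.
exists (fun s => cinv c (aff s)); split.
- move=> s /affP/sqX[x' [cx1 Xx'] x'E].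
  have hx' : cinv c (aff s) = x' by rewrite -x'E cmapK.
  have caff : {for s, continuous aff}.
    apply: at_contD; first exact: at_contK.
    by apply: at_contM; [exact: at_contK|exact: cvg_id].
  split.
  + by rewrite hx'.
  + apply: at_cont_comp caff _; rewrite -x'E; exact: cinv_continuous.
  + move=> c1 Bc1; rewrite hx' => c1x'.
    have h := transition_deriv Bc Bc1 cx1 c1x'.
    have ha : has_deriv aff s w by exact: has_deriv_affine.
    rewrite x'E in h.
    by have [] := has_derivP (has_deriv_comp ha h).
- by rewrite /aff mulr0 addr0 cmapK.
- have h := transition_deriv Bc Bc' cx cx'.
  have a0 : aff 0 = cmap c x by rewrite /aff mulr0 addr0.
  have ha : has_deriv aff 0 w by exact: has_deriv_affine.
  rewrite -a0 in h.
  by have [_ ->] := has_derivP (has_deriv_comp ha h).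
Qed.

End Charts.

(** * Lower bounds for the Riemannian distance *)


Lemma partition_piece (R : realType) (a b : R) (s : seq R) (t : R) :
  itv_partition a b s -> a < t < b -> t \notin s ->
  exists2 i, (i < size s)%N & nth 0 (a :: s) i < t < nth 0 s i.
Proof.
move=> [+ /eqP +]; elim: s a => [|x s IH] a /=.
  by move=> _ <- /andP[h1 h2]; move: (lt_trans h1 h2); rewrite ltxx.
move=> /andP[ax ps] lxs /andP[at_ tb]; rewrite inE negb_or => /andP[tx ts].
have [tx'|xt'|/eqP] := ltgtP t x; last by rewrite (negbTE tx).
  by exists 0%N => //=; rewrite at_.
have [|i si ti] := IH x ps lxs _ ts; first by rewrite xt' tb.
by exists i.+1.
Qed.

(** The time [s] is the supremum of the times spent outside [O]. The path lies in [O] immediately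
    afterwards, so [p s] is in the closure. *)
Lemma exit_time (R : realType) (T : topologicalType) (p : R -> T) (O : set T) :
  {within `[0, 1], continuous p} -> open O -> ~ O (p 0) -> O (p 1) ->
  exists s : R, [/\ 0 <= s < 1, ~ O (p s), closure O (p s) &
    forall t, s < t <= 1 -> O (p t)].
Proof.
move=> cp oO p0 p1.
have cpc : continuous (fun t => p (clamp t)).
  apply: (@within_retract R T R _ p clamp cp); first exact: continuous_clamp.
  by move=> t; rewrite /= in_itv/= clamp_itv.
pose A := [set t : R | 0 <= t <= 1 /\ ~ O (p t)].
have A0 : A 0 by split; rewrite // lexx ler01.
have Aub : ubound A 1 by move=> t [/andP[]].
have supA : has_sup A by split; [exists 0|exists 1].
pose s := sup A.
have s0 : 0 <= s by apply: ub_le_sup => //; exists 1.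
have s1 : s <= 1 by apply: ge_sup => //; exists 0.
have after t : s < t <= 1 -> O (p t).
  move=> /andP[st t1]; apply: contrapT => nO.
  have : t <= s by apply: ub_le_sup; [exists 1|split=> //; rewrite t1 (le_trans s0)// ltW].
  by rewrite leNgt st.
have ns : ~ O (p s).
  move=> Os; have : nbhs s (fun t => O (p (clamp t))).
    apply: (cpc s O); apply: open_nbhs_nbhs; split=> //.
    by rewrite clamp_id ?s0.
  move=> /nbhs_normP[e /= e0 eO].
  have [t [/andP[t0 t1] nOt] st] := sup_adherent e0 supA.
  apply: (nOt); have := eO t; rewrite /= clamp_id ?t0//; apply.
  have ts : t <= s by apply: ub_le_sup; [exists 1|split=> //; apply/andP].
  rewrite ger0_norm ?subr_ge0//; move: st; rewrite -/s => st; clear -st ts; lra.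
have s1' : s < 1.
  by rewrite lt_neqAle s1 andbT; apply/eqP => s1E; apply: ns; rewrite s1E.
exists s; split=> //; first by rewrite s0.
move=> U Us; have : nbhs s (fun t => U (p (clamp t))).
  by apply: (cpc s U); rewrite clamp_id ?s0.
move=> /nbhs_normP[e /= e0 eU].
pose t := Num.min 1 (s + e / 2).
have st : s < t by rewrite lt_min s1' ltrDl divr_gt0.
have t1 : t <= 1 by rewrite ge_min lexx.
exists (p t); split; first by apply: after; rewrite st.
have := eU t; rewrite /= clamp_id ?t1 ?(le_trans s0 (ltW st))//; apply.
rewrite distrC gtr0_norm ?subr_gt0//.
have : t <= s + e / 2 by rewrite ge_min lexx orbT.
lra.
Qed.

Section Tube.
Variables (R : realType) (T : topologicalType) (B : riemann_surface R T).
Variable d : riemannian_metric B.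
Local Notation C := (Cplx R).
Implicit Types (c : chart R T) (p : R -> T) (x y : T) (z w v : C) (X : set T).

Definition speed p (t : R) : R :=
  Num.sqrt (rm_form d (chart_at B (p t)) (cmap (chart_at B (p t)) (p t))
        (velocity (chart_at B (p t)) p t)).

Lemma chart_atP x : atlas B (chart_at B x) /\ cdom (chart_at B x) x.
Proof. by rewrite /chart_at; case: cid. Qed.

Lemma speedE c p t v : atlas B c -> (\forall u \near t, cdom c (p u)) ->
  chart_deriv c p t v -> speed p t = Num.sqrt (rm_form d c (cmap c (p t)) v).
Proof.
move=> Bc cp dp; have [Bc' cx'] := chart_atP (p t).
have cx := nbhs_singleton cp.
rewrite /speed (velocityE (chart_deriv_change Bc Bc' cp cx' dp)).
by rewrite (rm_compat d Bc Bc' cx cx').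
Qed.

Lemma smooth_fun_deriv (g : R -> R) t : smooth_fun g -> has_deriv g t (derive1 g t).
Proof. by move=> sg; apply: derivable_has_deriv; exact: (sg 0%N). Qed.

Lemma smooth_fun_continuous (g : R -> R) n : smooth_fun g -> continuous (derive1n n g).
Proof.
move=> sg t; apply: differentiable_continuous; apply/derivable1_diffP; exact: (sg n).
Qed.

Lemma continuous_rm_form c (g1 g2 h1 h2 : R -> R) (t : R) : atlas B c ->
  (cmap c @` cdom c) (mkC (g1 t) (g2 t)) ->
  {for t, continuous g1} -> {for t, continuous g2} ->
  {for t, continuous h1} -> {for t, continuous h2} ->
  {for t, continuous (fun u => rm_form d c (mkC (g1 u) (g2 u)) (mkC (h1 u) (h2 u)))}.
Proof.
move=> Bc ct cg1 cg2 ch1 ch2; have [sE sF sG] := rm_smooth d Bc.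
have cZ : {for t, continuous (fun u => mkC (g1 u) (g2 u))} by exact: continuousC_pair.
have cE : {for t, continuous (fun u => rmE d c (mkC (g1 u) (g2 u)))}.
  by apply: at_cont_comp cZ _; exact: (sE 0%N).1.
have cF : {for t, continuous (fun u => rmF d c (mkC (g1 u) (g2 u)))}.
  by apply: at_cont_comp cZ _; exact: (sF 0%N).1.
have cG : {for t, continuous (fun u => rmG d c (mkC (g1 u) (g2 u)))}.
  by apply: at_cont_comp cZ _; exact: (sG 0%N).1.
rewrite /rm_form /quad_form /=; apply: at_contD; first apply: at_contD.
- apply: at_contM => //; exact: at_contM.
- by apply: at_contM; apply: at_contM => //; exact: at_contK.
- apply: at_contM => //; exact: at_contM.
Qed.

(** The integrand [speed] uses a chart chosen separately at each point. By invariance of the metric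
    it agrees near [t] with its expression in one fixed chart, which is visibly continuous. *)
Lemma smooth_path_speed (a b : R) p t : smooth_path B a b p -> a < t < b ->
  {for t, continuous (speed p)} /\ exists c v,
  [/\ atlas B c, \forall u \near t, cdom c (p u) & chart_deriv c p t v].
Proof.
move=> sp /andP[at_ tb]; have [|c [g1 [g2 [Bc s1 s2 ct near_p]]]] := sp t.
  by rewrite !ltW.
have near2 : \forall u \near t, cdom c (p u) /\ cmap c (p u) = mkC (g1 u) (g2 u).
  have ha : nbhs t [set u | a < u] by exact: lt_nbhsr.
  have hb : nbhs t [set u | u < b] by exact: lt_nbhsl.
  by apply: filterS3 ha hb near_p => u /= au ub; apply; rewrite !ltW.
have hder u : (\forall u' \near u, cmap c (p u') = mkC (g1 u') (g2 u')) ->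
    chart_deriv c p u (mkC (derive1 g1 u) (derive1 g2 u)).
  move=> hu; split.
    by apply: has_deriv_near (smooth_fun_deriv u s1); apply: filterS hu => u' ->.
  by apply: has_deriv_near (smooth_fun_deriv u s2); apply: filterS hu => u' ->.
split; last first.
  exists c, (mkC (derive1 g1 t) (derive1 g2 t)); split=> //.
    by apply: filterS near2 => u [].
  by apply: hder; apply: filterS near2 => u [].
have eqs : \forall u \near t,
    Num.sqrt (rm_form d c (mkC (g1 u) (g2 u)) (mkC (derive1 g1 u) (derive1 g2 u))) = speed p u.
  (* The velocity at a nearby time [u] depends on the path on a neighbourhood of [u], so the local
     description is needed around each such [u]. *)
  have near3 := near_join near2.
  apply: filterS near3 => u hu.
  have [_ <-] := nbhs_singleton hu.
  apply/esym; apply: speedE => //; first by apply: filterS hu => u' [].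
  by apply: hder; apply: filterS hu => u' [].
apply: (near_eq_continuous eqs).
have hc : {for t, continuous (fun u => rm_form d c (mkC (g1 u) (g2 u)) (mkC (derive1 g1 u) (derive1 g2 u)))}.
  apply: continuous_rm_form => //.
  - by have [h1 <-] := nbhs_singleton near2; exists (p t).
  - exact: (@smooth_fun_continuous _ 0 s1 t).
  - exact: (@smooth_fun_continuous _ 0 s2 t).
  - exact: (@smooth_fun_continuous _ 1 s1 t).
  - exact: (@smooth_fun_continuous _ 1 s2 t).
by apply: at_cont_comp hc _; exact: sqrt_continuous.
Qed.

End Tube.


Lemma within_continuous_comp (X Y Z : topologicalType) (A : set X) (p : X -> Y) (g : Y -> Z) :
  {within A, continuous p} -> (forall x, A x -> {for p x, continuous g}) ->
  {within A, continuous (fun x => g (p x))}.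
Proof.
move=> /subspace_continuousP cp cg; apply/subspace_continuousP => x Ax U gU.
have h : nbhs (p x) (g @^-1` U) := cg x Ax U gU.
exact: (cp x Ax _ h).
Qed.

Lemma norm_sign_exists (R : realType) (a : R) : exists2 s : R, `|s| = 1 & s * a = `|a|.
Proof.
have [a0|a0] := leP 0 a.
  by exists 1; rewrite ?normr1// mul1r ger0_norm.
by exists (-1); rewrite ?normrN1// mulN1r ltr0_norm.
Qed.

Section Tube.
Variables (R : realType) (T : topologicalType) (B : riemann_surface R T).
Variable d : riemannian_metric B.
Local Notation C := (Cplx R).
Implicit Types (c : chart R T) (p : R -> T) (x y : T) (z w v : C) (X : set T).

Definition coord_sq c z (e : R) : set T := cdom c `&` cmap c @^-1` sq z e.

Lemma nbhs_sq z (e : R) w : sq z e w -> nbhs w (sq z e).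
Proof.
move=> [wr wi]; apply/nbhsC_sq.
exists (Num.min (e - `|ReC w - ReC z|) (e - `|ImC w - ImC z|)).
  by rewrite lt_min !subr_gt0 wr.
move=> w'; rewrite !lt_min => /andP[r1 _] /andP[_ i1]; split.
  rewrite (_ : _ - _ = (ReC w' - ReC w) + (ReC w - ReC z)); last ring.
  by apply: le_lt_trans (ler_normD _ _) _; lra.
rewrite (_ : _ - _ = (ImC w' - ImC w) + (ImC w - ImC z)); last ring.
by apply: le_lt_trans (ler_normD _ _) _; lra.
Qed.

Lemma open_coord_sq c z (e : R) : open (coord_sq c z e).
Proof.
rewrite openE => x [cx xz]; rewrite /interior.
have h1 : nbhs x (cdom c) by apply: open_nbhs_nbhs; split=> //; exact: cdom_open.
have h2 : nbhs x (cmap c @^-1` sq z e).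
  have cc := cmap_continuous cx; exact: (cc (sq z e) (nbhs_sq xz)).
exact: filterI.
Qed.

(** As the image of a compact square under the inverse chart, it is compact, hence closed in the
    Hausdorff surface. This keeps a limit of points of a smaller open square inside the chart. *)
Lemma closed_coord_sq c z (r e : R) : hausdorff_space T -> r < e ->
  sq z e `<=` cmap c @` cdom c ->
  closed [set x | [/\ cdom c x, `|ReC (cmap c x) - ReC z| <= r &
                     `|ImC (cmap c x) - ImC z| <= r]].
Proof.
move=> hT re ze; apply: compact_closed => //.
pose Q : set (R * R) := `[ReC z - r, ReC z + r] `*` `[ImC z - r, ImC z + r].
have QP ab : Q ab <-> `|ab.1 - ReC z| <= r /\ `|ab.2 - ImC z| <= r.
  by rewrite /Q /setX/= !in_itv/= !ler_distl.
have QE ab : Q ab -> exists2 x, cdom c x & cmap c x = mkC ab.1 ab.2.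
  move=> /QP[ar bi]; have [|x cx xE] := ze (mkC ab.1 ab.2).
    by split; apply: le_lt_trans re.
  by exists x.
have cQ : compact ((fun ab => cinv c (mkC ab.1 ab.2)) @` Q).
  apply: continuous_compact; last first.
    by apply: compact_setX; exact: segment_compact.
  apply: continuous_in_subspaceT => ab /set_mem/QE[x cx xE].
  apply: (@at_cont_comp _ _ _ (fun ab : R * R => mkC ab.1 ab.2) (cinv c)).
    by apply: continuousC_pair; [exact: cvg_fst|exact: cvg_snd].
  by rewrite -xE; exact: cinv_continuous.
rewrite (_ : [set _ | _] = (fun ab => cinv c (mkC ab.1 ab.2)) @` Q)//.
apply/seteqP; split=> [x [cx xr xi]|_ [ab Qab <-]] /=.
  exists (ReC (cmap c x), ImC (cmap c x)); first by apply/QP.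
  by rewrite /= mkC_eta cmapK.
have /QP[ar bi] := Qab; have [x cx xE] := QE _ Qab.
by rewrite -xE cmapK// xE.
Qed.

(** After its last time outside the half-size square the path stays in the large square, where the
    metric dominates [k] times the Euclidean one. Over that time one coordinate changes by at least
    [e / 2]. *)
Lemma riem_length_ge c x y p (e k : R) : atlas B c -> cdom c y -> 0 < e -> 0 < k ->
  sq (cmap c y) e `<=` cmap c @` cdom c ->
  (forall w v, sq (cmap c y) e w -> k ^+ 2 * (ReC v ^+ 2 + ImC v ^+ 2) <= rm_form d c w v) ->
  ~ coord_sq c (cmap c y) e x -> path_in setT x y p -> piecewise_smooth B p ->
  ((k * (e / 2))%:E <= riem_length d p)%E.
Proof.
move=> Bc cy e0 k0 ye formk nx hp [N [partN smN]].
have [cp p0 p1 _] := hp.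
have e2 : e / 2 < e by rewrite ltr_pdivrMr// ltr_pMr// ltr1n.
have e20 : 0 < e / 2 by rewrite divr_gt0.
pose O := coord_sq c (cmap c y) (e / 2).
have [|||s [/andP[s0 s1] nOs Os after]] := exit_time (O := O) cp.
- exact: open_coord_sq.
- by rewrite p0 => -[cx h]; apply: nx; split=> //; apply: sqW h; exact: ltW.
- by rewrite p1; split=> //; exact: sq_center.
have [cps psr psi] : [/\ cdom c (p s), `|ReC (cmap c (p s)) - ReC (cmap c y)| <= e / 2 &
                     `|ImC (cmap c (p s)) - ImC (cmap c y)| <= e / 2].
  have K := closed_coord_sq (rs_hausdorff B) e2 ye.
  rewrite closure_id in K; change (([set x | [/\ cdom c x, `|ReC (cmap c x) - ReC (cmap c y)| <= e / 2 &
                     `|ImC (cmap c x) - ImC (cmap c y)| <= e / 2]]) (p s)).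
  by rewrite K; apply: closureS Os => x' [cx' [/ltW ? /ltW ?]].
have inV t : s <= t <= 1 -> coord_sq c (cmap c y) e (p t).
  rewrite le_eqVlt => /andP[/predU1P[<- _|st t1]].
    by split=> //; split; exact: le_lt_trans e2.
  by have [] := after t; rewrite ?st// => ct h; split=> //; apply: sqW h; exact: ltW.
(* Here [f] is the coordinate that changes by [e / 2]. The sign [sg] orients it so that its
   increment is positive and can be compared with the integral of the speed. *)
have key (f : C -> R) : continuous f -> (forall v, `|f v| <= Num.sqrt (ReC v ^+ 2 + ImC v ^+ 2)) ->
    (forall t v, chart_deriv c p t v -> has_deriv (fun u => f (cmap c (p u))) t (f v)) ->
    e / 2 <= `|f (cmap c y) - f (cmap c (p s))| ->
    ((k * (e / 2))%:E <= riem_length d p)%E.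
  move=> cf fle fder fe.
  have [sg sg1 sgE] := norm_sign_exists (f (cmap c y) - f (cmap c (p s))).
  have := @le_integral_increment R (speed d p)
    (fun t => sg * k * f (cmap c (p t))) s 1 N (ltW s1) s0 (lexx 1).
  rewrite p1 -mulrBr mulrAC sgE => H; apply: (le_trans _ (H _ _ _)).
  - by rewrite lee_fin mulrC ler_pM2r.
  - by move=> t; exact: sqrtr_ge0.
  - apply: (@within_continuous_comp _ _ _ _ p (fun x => sg * k * f (cmap c x))).
      apply: continuous_subspaceW cp => t /=; rewrite !in_itv/= => /andP[st ->].
      by rewrite (le_trans s0).
    move=> t /=; rewrite in_itv/= => /inV[ct _].
    apply: at_contM; first exact: at_contK.
    by apply: at_cont_comp (cmap_continuous ct) _; exact: cf.
  - move=> t /andP[st t1] tN.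
    have [|i iN ti] := partition_piece partN _ tN; first by rewrite (le_lt_trans s0).
    have [cS [c' [v [Bc' c'p dv]]]] := smooth_path_speed d (smN i iN) ti; split=> //.
    have [|ct tsq] := inV t; first by rewrite !ltW.
    have dv' := chart_deriv_change Bc' Bc c'p ct dv.
    exists (sg * k * f (transition c' c (p t) * v)).
      have [q [cq <- qE]] := fder _ _ dv'; exists (fun u => sg * k * q u); split=> //.
        by apply: at_contM => //; exact: at_contK.
      by move=> u; rewrite -mulrBr qE mulrA.
    rewrite (speedE d Bc' c'p dv) (rm_compat d Bc' Bc (nbhs_singleton c'p) ct).
    apply: le_trans (ler_norm _) _; rewrite !normrM sg1 mul1r (gtr0_norm k0).
    apply: (@le_trans _ _ (k * Num.sqrt (ReC (transition c' c (p t) * v) ^+ 2 +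
                                         ImC (transition c' c (p t) * v) ^+ 2))).
      by rewrite ler_pM2l.
    rewrite -[X in X * _](gtr0_norm k0) -sqrtr_sqr -sqrtrM ?sqr_ge0//.
    have hk := formk _ (transition c' c (p t) * v) tsq.
    by rewrite ler_sqrt//; apply: le_trans hk; rewrite mulr_ge0// ?addr_ge0// sqr_ge0.
have [hr|hr] := leP (e / 2) `|ReC (cmap c y) - ReC (cmap c (p s))|.
  apply: (key (@ReC R)) => //; first exact: continuous_ReC.
    exact: ReC_le_sqrt.
  by move=> t v [].
have [hi|hi] := leP (e / 2) `|ImC (cmap c y) - ImC (cmap c (p s))|.
  apply: (key (@ImC R)) => //; first exact: continuous_ImC.
    exact: ImC_le_sqrt.
  by move=> t v [].
by exfalso; apply: nOs; split=> //; split; rewrite distrC.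
Qed.

End Tube.

(** * Piecewise smooth paths *)


Section PiecewiseSmooth.
Variables (R : realType) (T : topologicalType) (B : riemann_surface R T).
Local Notation C := (Cplx R).
Implicit Types (c : chart R T) (p q : R -> T) (a b : R).

Lemma smooth_fun_affine (g : R -> R) (a b : R) : smooth_fun g ->
  smooth_fun (fun u => g (a + b * u)).
Proof.
move=> sg n.
(* The summand [0] puts the chain-rule factor in the affine form of [has_deriv_affine]. *)
have H m : derive1n m (fun u => g (a + b * u)) = (fun u => 0 + b ^+ m * derive1n m g (a + b * u)) /\
    forall t, derivable (derive1n m (fun u => g (a + b * u))) t 1.
  elim: m => [|m [IH1 IH2]].
    have E : derive1n 0 (fun u => g (a + b * u)) = (fun u => 0 + b ^+ 0 * derive1n 0 g (a + b * u)).
      by apply/funext => u; rewrite /derive1n /= mul1r add0r.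
    split=> // t.
    have h1 : has_deriv g (a + b * t) (derive1 g (a + b * t)).
      by apply: derivable_has_deriv; exact: (sg 0%N).
    by have [] := has_derivP (has_deriv_comp (has_deriv_affine a b t) h1).
  have h k t : has_deriv (fun u => 0 + b ^+ k * derive1n k g (a + b * u)) t
      (b ^+ k * (derive1 (derive1n k g) (a + b * t) * b)).
    apply: (@has_deriv_comp _ (fun u => derive1n k g (a + b * u)) (fun x => 0 + b ^+ k * x)).
      apply: (@has_deriv_comp _ (fun u => a + b * u) (derive1n k g)); first exact: has_deriv_affine.
      by apply: derivable_has_deriv; exact: sg.
    exact: has_deriv_affine.
  have E : derive1n m.+1 (fun u => g (a + b * u)) = (fun u => 0 + b ^+ m.+1 * derive1n m.+1 g (a + b * u)).
    rewrite /derive1n iterS -/(derive1n m _) IH1; apply/funext => u.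
    have [_ ->] := has_derivP (h m u).
    by rewrite add0r exprSr -mulrA; congr (_ * _); rewrite mulrC.
  split=> // t; rewrite E.
  by have [] := has_derivP (h m.+1 t).
exact: (H n).2.
Qed.

Lemma smooth_fun_line (a b : R) : smooth_fun (fun u => a + b * u).
Proof.
have sid : smooth_fun (id : R -> R).
  move=> n; have H m : exists al be, derive1n m (id : R -> R) = (fun u => al + be * u).
    elim: m => [|m [al [be IH]]]; first by exists 0, 1; apply/funext => u; rewrite add0r mul1r.
    exists be, 0; rewrite /derive1n iterS -/(derive1n m _) IH; apply/funext => u.
    by have [_ ->] := has_derivP (has_deriv_affine al be u); rewrite mul0r addr0.
  have [al [be ->]] := H n => t.
  by have [] := has_derivP (has_deriv_affine al be t).
exact: (smooth_fun_affine (g := id)).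
Qed.

Lemma continuous_line (a b : R) : continuous (fun u : R => a + b * u).
Proof. by cont. Qed.

Lemma smooth_path_affine a b a' b' (al be : R) p q : smooth_path B a b p ->
  (forall u, a' <= u <= b' -> a <= al + be * u <= b /\ q u = p (al + be * u)) ->
  smooth_path B a' b' q.
Proof.
move=> sp H t tab; have [h1 h2] := H t tab.
have [c [g1 [g2 [Bc s1 s2 ct near_p]]]] := sp _ h1.
exists c, (fun u => g1 (al + be * u)), (fun u => g2 (al + be * u)).
split; [exact: Bc| | | |].
- exact: smooth_fun_affine.
- exact: smooth_fun_affine.
- by rewrite h2.
- have cl : {for t, continuous (fun u : R => al + be * u)} by exact: continuous_line.
  have near2 := cl _ near_p.
  have {}near2 : \forall u \near t, a <= al + be * u <= b ->
    cdom c (p (al + be * u)) /\ cmap c (p (al + be * u)) = (g1 (al + be * u) +i* g2 (al + be * u))%C.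
    exact: near2.
  by apply: filterS near2 => u hu uab; have [i1 ->] := H u uab; exact: hu.
Qed.

(** Gluing is a constructor, which makes concatenation and rescaling inductions; an explicit
    partition is extracted only at the end. *)
Inductive pws p : R -> R -> Prop :=
| pws_smooth a b : a < b -> smooth_path B a b p -> pws p a b
| pws_cat a m b : pws p a m -> pws p m b -> pws p a b.

Lemma pws_lt p a b : pws p a b -> a < b.
Proof. by elim=> // a' m b' _ h1 _ h2; exact: lt_trans h2. Qed.

Lemma pws_partition p a b : pws p a b -> exists s, itv_partition a b s /\
  forall i, (i < size s)%N -> smooth_path B (nth 0 (a :: s) i) (nth 0 s i) p.
Proof.
elim=> [{}a {}b ab sp|{}a m {}b _ [s1 [[p1 /eqP l1] h1]] _ [s2 [[p2 /eqP l2] h2]]].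
  exists [:: b]; split; first by split; rewrite //= ab.
  by case=> //=.
exists (s1 ++ s2); split.
  by split; rewrite ?cat_path ?p1 ?l1// last_cat l1 l2.
move=> i; rewrite size_cat => i12; rewrite nth_cat -cat_cons nth_cat /= ltnS.
have [i1|i1] := ltnP i (size s1); first by rewrite (ltnW i1); exact: h1.
have := h2 (i - size s1)%N; rewrite ltn_subLR// => /(_ i12).
have [ile|ilt] := leqP i (size s1).
  have -> : i = size s1 by apply/eqP; rewrite eqn_leq ile.
  by rewrite subnn /= -last_nth l1.
by rewrite -(subnSK ilt).
Qed.

Lemma pws_affine p q a b (al be a' b' : R) : pws p a b -> 0 < be ->
  a = al + be * a' -> b = al + be * b' ->
  (forall u, a' <= u <= b' -> q u = p (al + be * u)) -> pws q a' b'.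
Proof.
move=> H be0; elim: H a' b' => [{}a {}b ab sp|{}a m {}b h1 IH1 h2 IH2] a' b' aE bE qp.
  apply: pws_smooth.
    by move: ab; rewrite aE bE ltrD2l ltr_pM2l.
  apply: (smooth_path_affine sp (al := al) (be := be)) => u /[dup] /qp -> /andP[au ub].
  by split=> //; rewrite aE bE !lerD2l !ler_pM2l// au.
have mE : m = al + be * ((m - al) / be) by rewrite mulrCA divff ?gt_eqF// mulr1 addrC subrK.
have am : a' <= (m - al) / be.
  by move: (pws_lt h1); rewrite aE mE ltrD2l ltr_pM2l// => /ltW; rewrite -mE.
have mb : (m - al) / be <= b'.
  by move: (pws_lt h2); rewrite bE mE ltrD2l ltr_pM2l// => /ltW; rewrite -mE.
apply: (@pws_cat _ _ ((m - al) / be)).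
  by apply: IH1 => // u /andP[au um]; apply: qp; rewrite au (le_trans um).
by apply: IH2 => // u /andP[mu ub]; apply: qp; rewrite ub andbT (le_trans am).
Qed.

Lemma pws_concat p q : p 1 = q 0 -> pws p 0 1 -> pws q 0 1 -> pws (path_concat p q) 0 1.
Proof.
move=> pq hp hq; apply: (@pws_cat _ _ 2^-1).
  apply: (pws_affine hp (al := 0) (be := 2)); rewrite ?mulr0 ?addr0 ?add0r ?mulfV//.
  by move=> u /andP[_ u2]; rewrite /path_concat u2 add0r.
apply: (pws_affine hq (al := -1) (be := 2)); rewrite ?mulfV ?addNr//; first by lra.
move=> u /andP[u2 _]; rewrite /path_concat addrC.
case: ifP => // u2'; have -> : u = 2^-1 by apply/eqP; rewrite eq_le u2 u2'.
by rewrite mulfV// addNr.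
Qed.

Lemma pws_piecewise_smooth p : pws p 0 1 -> piecewise_smooth B p.
Proof. by move=> /pws_partition[s [hs h]]; exists s; split. Qed.

End PiecewiseSmooth.

(** * Coordinate squares *)


Section Boxes.
Variables (R : realType) (T : topologicalType) (B : riemann_surface R T).
Variable d : riemannian_metric B.
Local Notation C := (Cplx R).
Implicit Types (c : chart R T) (p q g : R -> T) (x y : T) (z w : C) (X : set T) (S : seq T).

Definition normsq z : R := ReC z ^+ 2 + ImC z ^+ 2.

(** Everything is controlled on the square of half-side [2 * brad], while points are taken in the
    one of half-side [brad]. So each such point has a square of half-side [brad] around it under
    control. The number [bmet] bounds the metric from below by a multiple of the Euclidean one. *)
Record box X := Box {
  bchart : chart R T;
  bcenter : C;
  brad : R;
  bmet : R;
  box_atlas : atlas B bchart;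
  brad_gt0 : 0 < brad;
  bmet_gt0 : 0 < bmet;
  box_sub : sq bcenter (2 * brad) `<=` cmap bchart @` (cdom bchart `&` X);
  box_form : forall w v, sq bcenter (2 * brad) w ->
    bmet ^+ 2 * normsq v <= rm_form d bchart w v }.

Definition reg X (b : box X) : set T := coord_sq (bchart b) (bcenter b) (brad b).

(** The smallest eigenvalue of a positive symmetric matrix [M] is at least [det M / tr M]. Indeed
    [tr M * <Mv, v> - det M * |v|^2 = |Mv|^2] by Cayley-Hamilton. *)
Lemma quad_form_ge (E F G k : R) z : 0 < E -> 0 < G ->
  k * (E + G) <= E * G - F ^+ 2 -> k * normsq z <= quad_form E F G z.
Proof.
move=> E0 G0 hk; rewrite -(ler_pM2r (addr_gt0 E0 G0)).
rewrite mulrAC; apply: le_trans (_ : (E * G - F ^+ 2) * normsq z <= _).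
  by apply: ler_wpM2r hk; rewrite addr_ge0 ?sqr_ge0.
rewrite /quad_form /normsq /ReC /ImC; set a := complex.Re z; set b := complex.Im z.
have h : 0 <= (E * a + F * b) ^+ 2 + (F * a + G * b) ^+ 2 by rewrite addr_ge0 ?sqr_ge0.
rewrite -subr_ge0; apply: le_trans h _; rewrite le_eqVlt; apply/orP; left; apply/eqP; ring.
Qed.

Lemma box_at X x : open X -> X x -> exists b : box X, reg b x.
Proof.
move=> oX Xx; have [c [Bc cx]] := atlas_cover B x.
set z := cmap c x.
have Oz : (cmap c @` cdom c) z by exists x.
have [sE sF sG] := rm_smooth d Bc.
have cE : {for z, continuous (rmE d c)} := (sE 0%N).1 z Oz.
have cF : {for z, continuous (rmF d c)} := (sF 0%N).1 z Oz.
have cG : {for z, continuous (rmG d c)} := (sG 0%N).1 z Oz.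
have pos (a b : R) : mkC a b != 0 ->
    0 < rmE d c z * a ^+ 2 + 2 * rmF d c z * (a * b) + rmG d c z * b ^+ 2.
  by move=> ab; have := rm_pos d Bc cx ab.
have nz (a b : R) : (a != 0) || (b != 0) -> mkC a b != 0.
  by apply: contraTneq => -[-> ->]; rewrite eqxx.
have E0 : 0 < rmE d c z.
  by have := pos 1 0 (nz 1 0 _); rewrite oner_neq0 => /(_ isT);
    rewrite !(mul0r, mulr0, expr0n, addr0)/= expr1n mulr1.
have G0 : 0 < rmG d c z.
  have := pos 0 1 (nz 0 1 _); rewrite oner_neq0 orbT => /(_ isT).
  by rewrite !(mul0r, mulr0, expr0n, addr0, add0r)/= expr1n mulr1.
have det0 : 0 < rmE d c z * rmG d c z - rmF d c z ^+ 2.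
  (* On the vector [(F, -E)] the form takes the value [E * (E * G - F ^ 2)]. *)
  have := pos (rmF d c z) (- rmE d c z) (nz _ _ _).
  rewrite oppr_eq0 (gt_eqF E0) orbT => /(_ isT).
  rewrite (_ : _ + _ = rmE d c z * (rmE d c z * rmG d c z - rmF d c z ^+ 2)); last by ring.
  by rewrite pmulr_rgt0.
set det := _ - _ in det0; set tr := rmE d c z + rmG d c z.
have tr0 : 0 < tr by rewrite addr_gt0.
(* Half of [det / tr] leaves room for the strict inequality [0 < Q] to persist near [z] by
   continuity. *)
pose k := Num.sqrt (det / tr / 2).
have k2 : k ^+ 2 = det / tr / 2 by rewrite sqr_sqrtr// !divr_ge0// ltW.
have k0 : 0 < k by rewrite sqrtr_gt0 !divr_gt0.
pose Q w := rmE d c w * rmG d c w - rmF d c w * rmF d c w - k ^+ 2 * (rmE d c w + rmG d c w).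
have cQ : {for z, continuous Q}.
  apply: at_contB; first by apply: at_contB; exact: at_contM.
  by apply: at_contM; [exact: at_contK|exact: at_contD].
have Q0 : 0 < Q z.
  have -> : Q z = det / 2.
    by rewrite /Q k2 -/tr -expr2 -/det mulrAC divfK ?gt_eqF//; lra.
  by rewrite divr_gt0.
have nE : nbhs z [set w | 0 < rmE d c w] := cE _ (lt_nbhsr E0).
have nG : nbhs z [set w | 0 < rmG d c w] := cG _ (lt_nbhsr G0).
have nQ : nbhs z [set w | 0 < Q w] := cQ _ (lt_nbhsr Q0).
have nX : nbhs z (cmap c @` (cdom c `&` X)).
  have n1 : nbhs z (cmap c @` cdom c).
    by apply: open_nbhs_nbhs; split=> //; exact: cimg_open.
  have n2 : nbhs z (cinv c @^-1` X).
    have cc := cinv_continuous cx; apply: (cc X).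
    by rewrite cmapK//; apply: open_nbhs_nbhs.
  apply: filterS2 n1 n2 => w [x' cx' <-] /=; rewrite cmapK// => Xx'.
  by exists x'.
have nall : nbhs z [set w | [/\ 0 < rmE d c w, 0 < rmG d c w, 0 < Q w &
    (cmap c @` (cdom c `&` X)) w]].
  by apply: filterS2 (filterI nE nG) (filterI nQ nX) => w /= [? ?] [? ?].
have [r r0 hr] := (nbhsC_sq _ _).1 nall.
have rr : 2 * (r / 2) = r by rewrite mulrC divfK.
unshelve eexists (@Box X c z (r / 2) k Bc _ k0 _ _).
- by rewrite divr_gt0.
- by rewrite rr => w [wr wi]; have [] := hr w wr wi.
- rewrite rr => w v [wr wi]; have [hE hG hQ _] := hr w wr wi.
  by apply: quad_form_ge => //; move: hQ; rewrite /Q /= subr_gt0 -expr2 => /ltW.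
- by split=> //; apply: sq_center; rewrite divr_gt0.
Qed.

Lemma box_cinv X (b : box X) w : sq (bcenter b) (2 * brad b) w ->
  [/\ cdom (bchart b) (cinv (bchart b) w), X (cinv (bchart b) w)
    & cmap (bchart b) (cinv (bchart b) w) = w].
Proof. by move=> /(box_sub (b := b))[x [cx Xx] <-]; rewrite cmapK. Qed.

Lemma sq_brad X (b : box X) : sq (bcenter b) (brad b) `<=` sq (bcenter b) (2 * brad b).
Proof. by apply: sqW; have := brad_gt0 b; lra. Qed.

Lemma reg_sub X (b : box X) : reg b `<=` X.
Proof.
move=> x [cx xs]; have [_ + _] := box_cinv (sq_brad xs).
by rewrite cmapK.
Qed.

Lemma reg_cinv X (b : box X) w : sq (bcenter b) (brad b) w -> reg b (cinv (bchart b) w).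
Proof. by move=> h; have [h1 h2 h3] := box_cinv (sq_brad h); split=> //; rewrite /= h3. Qed.

(** What the distance estimate needs at a point: a coordinate square inside [X] with a lower bound
    of the metric on it. *)
Definition safe X (e k : R) y := exists c, [/\ atlas B c, cdom c y,
  sq (cmap c y) e `<=` cmap c @` (cdom c `&` X) &
  forall w v, sq (cmap c y) e w -> k ^+ 2 * normsq v <= rm_form d c w v].

Lemma safe_in X e k y : 0 < e -> safe X e k y -> X y.
Proof.
move=> e0 [c [Bc cy sX _]]; have [x [cx Xx] xy] := sX _ (sq_center _ e0).
by rewrite -(cmapK cy) -xy cmapK.
Qed.

Lemma safe_dist X e k x y : 0 < e -> 0 < k -> safe X e k y -> ~ X x ->
  ((k * (e / 2))%:E <= riem_dist d x y)%E.
Proof.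
move=> e0 k0 [c [Bc cy sX form]] nXx.
apply: le_ereal_inf_tmp => _ [p [hp sp] <-].
apply: (riem_length_ge Bc cy e0 k0 _ form _ hp sp).
  by move=> w /sX[x' [cx' _] <-]; exists x'.
move=> [cx /sX[x' [cx' Xx'] xx']]; apply: nXx.
by rewrite -(cmapK cx) -xx' cmapK.
Qed.

Lemma safe_le X e k k' y : 0 <= k' -> k' <= k -> safe X e k y -> safe X e k' y.
Proof.
move=> k0 kk [c [Bc cy sX form]]; exists c; split=> // w v hw; have h := form w v hw; apply: le_trans h.
by apply: ler_wpM2r; rewrite ?addr_ge0 ?sqr_ge0// lerXn2r// nnegrE// (le_trans k0).
Qed.

(** What the Kobayashi estimate needs at a time: a coordinate square inside [X] and a coordinate
    velocity bounded by [W]. The chart may vary with the time. *)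
Definition slow X (e W : R) g (t : R) := exists c w, [/\ atlas B c,
  \forall u \near t, cdom c (g u), chart_deriv c g t w, `|w| <= (W%:C)%C &
  sq (cmap c (g t)) e `<=` cmap c @` (cdom c `&` X)].

Lemma slow_kobayashi X e W g t : 0 < e -> 0 < W -> slow X e W g t ->
  (kobayashi B X (chart_at B (g t)) (g t) (velocity (chart_at B (g t)) g t)
    <= (2 * W / e)%:E)%E.
Proof.
move=> e0 W0 [c [w [Bc cg dg wW sX]]].
have [Bc' cg'] := chart_atP B (g t).
rewrite (velocityE (chart_deriv_change Bc Bc' cg cg' dg)).
exact: kobayashi_le (nbhs_singleton cg) _ _ _ _ _.
Qed.

(** The finite list [N] absorbs the junctions of concatenations, where the velocity may fail to
    exist. Safety is required at every time, since the tube involves the whole image. *)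
Definition nice X (e k W : R) u v g := [/\ path_in X u v g, pws B g 0 1,
  forall t, 0 <= t <= 1 -> safe X e k (g t) &
  exists N : seq R, forall t, 0 <= t <= 1 -> t \notin N -> slow X e W g t].

Lemma nice_le X e k k' W W' u v g : 0 <= k' -> k' <= k -> W <= W' ->
  nice X e k W u v g -> nice X e k' W' u v g.
Proof.
move=> k0 kk WW [h1 h2 h3 [N h4]]; split=> //.
  by move=> t /h3; exact: safe_le.
exists N => t t01 tN; have [c [w [Bc cg dg wW sX]]] := h4 t t01 tN.
by exists c, w; split=> //; apply: le_trans wW _; rewrite lecR.
Qed.

Lemma chart_deriv_affine c g t (al be : R) w : chart_deriv c g (al + be * t) w ->
  chart_deriv c (fun u => g (al + be * u)) t (mkC be 0 * w).
Proof.
move=> [hr hi]; split.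
  have := has_deriv_comp (has_deriv_affine al be t) hr.
  by rewrite !ReImC mul0r subr0 mulrC.
have := has_deriv_comp (has_deriv_affine al be t) hi.
by rewrite !ReImC mul0r addr0 mulrC.
Qed.

Lemma chart_deriv_near c g g' t w : (\forall u \near t, g u = g' u) ->
  chart_deriv c g t w -> chart_deriv c g' t w.
Proof.
move=> gg [hr hi]; split; [apply: has_deriv_near hr|apply: has_deriv_near hi].
  by apply: filterS gg => u ->.
by apply: filterS gg => u ->.
Qed.

Lemma slow_affine X e W g g' t (al be : R) : 0 < be -> slow X e W g (al + be * t) ->
  (\forall u \near t, g (al + be * u) = g' u) -> slow X e (be * W) g' t.
Proof.
move=> be0 [c [w [Bc cg dg wW sX]]] gg.
have cl : {for t, continuous (fun u : R => al + be * u)} by exact: continuous_line.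
exists c, (mkC be 0 * w); split=> //.
- have near2 : \forall u \near t, cdom c (g (al + be * u)) by exact: (cl _ cg).
  by apply: filterS2 gg near2 => u <-.
- by apply: chart_deriv_near gg _; exact: chart_deriv_affine.
- rewrite normrM rmorphM; apply: ler_pM => //.
  by rewrite normc_def /= expr0n addr0 sqrtr_sqr gtr0_norm.
- by rewrite -(nbhs_singleton gg).
Qed.

(** Both halves are run at double speed, hence the factor 2; the exceptional times are the rescaled
    ones together with the junction. *)
Lemma nice_concat X e k W u v y g g' : nice X e k W u v g -> nice X e k W v y g' ->
  nice X e k (2 * W) u y (path_concat g g').
Proof.
move=> [h1 h2 h3 [N hN]] [h1' h2' h3' [N' hN']].
have [_ _ gv _] := path_inE h1; have [_ gv' _ _] := path_inE h1'.
split; first exact: path_concat_in h1'.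
- by apply: pws_concat => //; rewrite gv gv'.
- move=> t t01; rewrite /path_concat; case: ifPn => [t2|].
    by apply: h3; lra.
  by rewrite -ltNge => t2; apply: h3'; lra.
exists (2^-1 :: [seq s / 2 | s <- N] ++ [seq (s + 1) / 2 | s <- N']) => t t01.
rewrite inE mem_cat !negb_or => /and3P[t2 tN tN'].
have [tl|tg|tE] := ltgtP t 2^-1; last by rewrite tE eqxx in t2.
  apply: (@slow_affine _ _ _ g _ _ 0 2) => //.
    apply: hN; first by lra.
    by apply: contra tN => h; apply/mapP; exists (0 + 2 * t) => //; rewrite add0r [2 * t]mulrC mulfK.
  have nt : \forall u \near t, u < 2^-1 by exact: lt_nbhsl.
  by apply: filterS nt => s s2; rewrite /path_concat ltW// add0r.
apply: (@slow_affine _ _ _ g' _ _ (-1) 2) => //.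
  apply: hN'; first by lra.
  apply: contra tN' => h; apply/mapP; exists (-1 + 2 * t) => //.
  by rewrite addrAC addNr add0r [2 * t]mulrC mulfK.
have nt : \forall u \near t, 2^-1 < u by exact: lt_nbhsr.
by apply: filterS nt => s s2; rewrite /path_concat leNgt s2 /= addrC.
Qed.

End Boxes.

(** * Good lines in a square *)


Lemma convex_lt (R : realFieldType) (a b r t : R) :
  a < r -> b < r -> 0 <= t <= 1 -> a + (b - a) * t < r.
Proof.
move=> ar br /andP[t0 t1]; have [ab|ba] := leP a b.
  by apply: le_lt_trans br; nra.
by apply: le_lt_trans ar; nra.
Qed.

Section Reach.
Variables (R : realType) (T : topologicalType) (B : riemann_surface R T).
Variable d : riemannian_metric B.
Local Notation C := (Cplx R).
Implicit Types (c : chart R T) (p q g : R -> T) (x y : T) (z w : C) (X : set T) (S : seq T).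
Local Notation box := (box d).
Local Notation nice := (nice d).

(** Fixing the coordinate of index [true] gives a horizontal line, and [false] a vertical one. *)
Definition coord (i : bool) z : R := if i then ImC z else ReC z.

Definition good_line c S (e : R) (i : bool) (a : R) :=
  forall s, s \in S -> cdom c s -> e <= `|a - coord i (cmap c s)|.

Definition good c S (e : R) z := exists i, good_line c S e i (coord i z).

Definition good_pt X (b : box X) S e y := reg b y /\ good (bchart b) S e (cmap (bchart b) y).

Definition lin z w (t : R) : C :=
  mkC (ReC z + (ReC w - ReC z) * t) (ImC z + (ImC w - ImC z) * t).

Lemma lin0 z w : lin z w 0 = z.
Proof. by rewrite /lin !mulr0 !addr0 mkC_eta. Qed.
Lemma lin1 z w : lin z w 1 = w.
Proof. by rewrite /lin !mulr1 ![_ + (_ - _)]addrC !subrK mkC_eta. Qed.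

Lemma sq_convex z (r : R) w w' (t : R) : sq z r w -> sq z r w' -> 0 <= t <= 1 ->
  sq z r (lin w w' t).
Proof.
move=> [wr wi] [wr' wi'] t01.
have h (f : C -> R) : `|f w - f z| < r -> `|f w' - f z| < r ->
    `|f w + (f w' - f w) * t - f z| < r.
  rewrite !ltr_norml => /andP[a1 a2] /andP[a3 a4].
  have := convex_lt a2 a4 t01.
  have a1' : - (f w - f z) < r by lra.
  have a3' : - (f w' - f z) < r by lra.
  by have := convex_lt a1' a3' t01; lra.
by split; [exact: (h (@ReC R))|exact: (h (@ImC R))].
Qed.

Lemma continuous_lin z w : continuous (lin z w).
Proof.
move=> t; apply: continuousC_pair.
  exact: (@continuous_line R (ReC z) (ReC w - ReC z) t).
exact: (@continuous_line R (ImC z) (ImC w - ImC z) t).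
Qed.

Definition seg X (b : box X) z w (t : R) : T := cinv (bchart b) (lin z w t).

Lemma seg_path X (b : box X) z w : sq (bcenter b) (brad b) z -> sq (bcenter b) (brad b) w ->
  path_in (reg b) (cinv (bchart b) z) (cinv (bchart b) w) (seg b z w).
Proof.
move=> sz sw; have inr t : 0 <= t <= 1 -> reg b (seg b z w t).
  by move=> t01; apply: reg_cinv; exact: sq_convex.
apply: (@path_inI _ _ _ _ _ _ (fun t => seg b z w (clamp t))).
- move=> t; have cc : {for t, continuous (fun u => lin z w (clamp u))}.
    apply: at_cont_comp; last exact: continuous_lin.
    exact: continuous_clamp.
  apply: at_cont_comp cc _.
  have [cx Xx xE] := box_cinv (sq_brad (sq_convex sz sw (clamp_itv t))).
  by rewrite -{1}xE; exact: cinv_continuous.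
- by move=> t t01; rewrite clamp_id.
- by rewrite /seg lin0.
- by rewrite /seg lin1.
- exact: inr.
Qed.

Lemma seg_deriv X (b : box X) z w (t : R) : sq (bcenter b) (brad b) (lin z w t) ->
  (\forall u \near t, cdom (bchart b) (seg b z w u)) /\
  chart_deriv (bchart b) (seg b z w) t (w - z).
Proof.
move=> st; have cl : {for t, continuous (lin z w)} by exact: continuous_lin.
have near_sq : \forall u \near t, sq (bcenter b) (brad b) (lin z w u) by exact: (cl _ (nbhs_sq st)).
split; first by apply: filterS near_sq => u /reg_cinv[].
split.
  apply: has_deriv_near (_ : has_deriv (fun u => ReC z + (ReC w - ReC z) * u) t _).
    by apply: filterS near_sq => u /sq_brad/box_cinv[_ _ ->].
  by rewrite !ReImC; exact: has_deriv_affine.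
apply: has_deriv_near (_ : has_deriv (fun u => ImC z + (ImC w - ImC z) * u) t _).
  by apply: filterS near_sq => u /sq_brad/box_cinv[_ _ ->].
by rewrite !ReImC; exact: has_deriv_affine.
Qed.

Lemma seg_smooth X (b : box X) z w : sq (bcenter b) (brad b) z -> sq (bcenter b) (brad b) w ->
  smooth_path B 0 1 (seg b z w).
Proof.
move=> sz sw t t01.
have inr u : 0 <= u <= 1 -> cdom (bchart b) (seg b z w u) /\
    cmap (bchart b) (seg b z w u) = lin z w u.
  by move=> u01; have [] := box_cinv (sq_brad (sq_convex sz sw u01)).
exists (bchart b), (fun u => ReC z + (ReC w - ReC z) * u), (fun u => ImC z + (ImC w - ImC z) * u).
split; [exact: box_atlas|exact: smooth_fun_line|exact: smooth_fun_line|by have [] := inr t t01|].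
by apply: (@filterE _ (nbhs t) (nbhs_filter t)) => u; exact: inr.
Qed.

(** A point of [S] in this square would be [e]-close to [w] in both coordinates, including the one
    that is good. *)
Lemma good_sq X (b : box X) S e w : 0 < e -> e <= brad b ->
  sq (bcenter b) (brad b) w -> good (bchart b) S e w ->
  sq w e `<=` cmap (bchart b) @` (cdom (bchart b) `&` (X `\` [set` S])).
Proof.
move=> e0 eb [wr wi] [i gi] w' [w'r w'i].
have [|cx Xx xE] := @box_cinv _ _ _ _ _ b w'.
  split.
    rewrite (_ : _ - _ = (ReC w' - ReC w) + (ReC w - ReC (bcenter b))); last ring.
    by apply: le_lt_trans (ler_normD _ _) _; lra.
  rewrite (_ : _ - _ = (ImC w' - ImC w) + (ImC w - ImC (bcenter b))); last ring.
  by apply: le_lt_trans (ler_normD _ _) _; lra.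
exists (cinv (bchart b) w') => //; split=> //; split=> // xS.
have := gi _ xS cx; rewrite xE leNgt => /negP; apply.
by case: (i); rewrite /= distrC.
Qed.

Lemma good_safe X (b : box X) S e w : 0 < e -> e <= brad b ->
  sq (bcenter b) (brad b) w -> good (bchart b) S e w ->
  safe d (X `\` [set` S]) e (bmet b) (cinv (bchart b) w).
Proof.
move=> e0 eb sw gw; have [cx Xx xE] := box_cinv (sq_brad sw).
exists (bchart b); split=> //; first exact: box_atlas.
  by rewrite xE; exact: good_sq.
rewrite xE => w' v [w'r w'i]; apply: box_form.
have [wr wi] := sw; split.
  rewrite (_ : _ - _ = (ReC w' - ReC w) + (ReC w - ReC (bcenter b))); last ring.
  by apply: le_lt_trans (ler_normD _ _) _; lra.
rewrite (_ : _ - _ = (ImC w' - ImC w) + (ImC w - ImC (bcenter b))); last ring.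
by apply: le_lt_trans (ler_normD _ _) _; lra.
Qed.

Lemma normC_le z (a : R) : `|ReC z| + `|ImC z| <= a -> `|z| <= (a%:C)%C.
Proof. by move=> h; rewrite /Cplx normc_def lecR; exact: le_trans (sqrt_le_ReImC z) h. Qed.

(** Each coordinate of [w - z] is smaller than [2 * brad b], whence the speed bound [4 * brad b]. *)
Lemma seg_nice X (b : box X) S e z w : 0 < e -> e <= brad b ->
  sq (bcenter b) (brad b) z -> sq (bcenter b) (brad b) w ->
  (forall t, 0 <= t <= 1 -> good (bchart b) S e (lin z w t)) ->
  nice (X `\` [set` S]) e (bmet b) (4 * brad b)
    (cinv (bchart b) z) (cinv (bchart b) w) (seg b z w).
Proof.
move=> e0 eb sz sw gl.
have sf t : 0 <= t <= 1 -> safe d (X `\` [set` S]) e (bmet b) (seg b z w t).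
  by move=> t01; apply: good_safe => //; [exact: sq_convex|exact: gl].
have [cs s0 s1 _] := seg_path sz sw.
split=> //.
- split=> // _ [t /= + <-]; rewrite in_itv/= => t01; exact: safe_in e0 (sf t t01).
- by apply: pws_smooth; [exact: ltr01|exact: seg_smooth].
exists [::] => t t01 _.
have sl := sq_convex sz sw t01.
have [ncd dv] := seg_deriv sl.
exists (bchart b), (w - z); split=> //; first exact: box_atlas.
- apply: normC_le; rewrite !ReImC; have [zr zi] := sz; have [wr wi] := sw.
  rewrite (_ : ReC w - _ = (ReC w - ReC (bcenter b)) - (ReC z - ReC (bcenter b))); last ring.
  rewrite (_ : ImC w - _ = (ImC w - ImC (bcenter b)) - (ImC z - ImC (bcenter b))); last ring.
  have h1 := ler_normB (ReC w - ReC (bcenter b)) (ReC z - ReC (bcenter b)).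
  have h2 := ler_normB (ImC w - ImC (bcenter b)) (ImC z - ImC (bcenter b)).
  by apply: le_trans (lerD h1 h2) _; lra.
have [_ _ ->] := box_cinv (sq_brad sl).
by apply: good_sq => //; exact: gl.
Qed.

Definition joined X (b : box X) S e W u v := exists g,
  path_in (reg b) u v g /\ nice (X `\` [set` S]) e (bmet b) W u v g.

Lemma joined_trans X (b : box X) S e W u v y :
  joined b S e W u v -> joined b S e W v y -> joined b S e (2 * W) u y.
Proof.
move=> [g [h1 n1]] [g' [h2 n2]]; exists (path_concat g g'); split.
  exact: path_concat_in h2.
exact: nice_concat n2.
Qed.

Lemma joined_line X (b : box X) S e z w i : 0 < e -> e <= brad b ->
  sq (bcenter b) (brad b) z -> sq (bcenter b) (brad b) w ->
  coord i z = coord i w -> good_line (bchart b) S e i (coord i z) ->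
  joined b S e (4 * brad b) (cinv (bchart b) z) (cinv (bchart b) w).
Proof.
move=> e0 eb sz sw zw gz; exists (seg b z w); split; first exact: seg_path.
apply: seg_nice => // t t01; exists i.
rewrite (_ : coord i (lin z w t) = coord i z)//.
by case: (i) zw => /= <-; rewrite subrr mul0r addr0.
Qed.

(** The hub is the intersection of a good vertical and a good horizontal line. A good point follows
    its own line until it meets the hub line of the other direction, then that line to the hub.
    Joining two points through the hub takes two rounds of concatenation, so the speed grows from
    [4 * brad b] to [16 * brad b]. *)
Lemma box_connect X (b : box X) : exists2 A : R, 0 < A &
  forall S e, 0 < e -> e <= A / (size S).+1%:R ->
  forall u v, good_pt b S e u -> good_pt b S e v -> joined b S e (16 * brad b) u v.
Proof.
have r0 := brad_gt0 b.
have itv (a : R) : a - brad b < a + brad b by lra.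
have [A1 A10 H1] := fat_itv (itv (ReC (bcenter b))).
have [A2 A20 H2] := fat_itv (itv (ImC (bcenter b))).
exists (Num.min (brad b) (Num.min A1 A2)); first by rewrite !lt_min r0 A10.
move=> S e e0 eA u v gu gv.
have n0 : 0 < (size S).+1%:R :> R by rewrite ltr0n.
move: eA; rewrite ler_pdivlMr// !le_min => /and3P[er e1 e2].
have eb : e <= brad b.
  by apply: le_trans er; apply: ler_peMr; [exact: ltW|rewrite ler1n].
have [a0 a0i ga0] := H1 [seq ReC (cmap (bchart b) s) | s <- S].
have [b0 b0i gb0] := H2 [seq ImC (cmap (bchart b) s) | s <- S].
have ga : good_line (bchart b) S e false a0.
  move=> s sS _; apply: le_trans (ga0 _ (map_f _ sS)).
  by rewrite size_map ler_pdivlMr.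
have gb : good_line (bchart b) S e true b0.
  move=> s sS _; apply: le_trans (gb0 _ (map_f _ sS)).
  by rewrite size_map ler_pdivlMr.
have ra : `|a0 - ReC (bcenter b)| < brad b by move: a0i; rewrite /= in_itv/= ltr_distl.
have rb : `|b0 - ImC (bcenter b)| < brad b by move: b0i; rewrite /= in_itv/= ltr_distl.
pose hub := mkC a0 b0.
have shub : sq (bcenter b) (brad b) hub by split.
have to_hub y : good_pt b S e y ->
    joined b S e (2 * (4 * brad b)) y (cinv (bchart b) hub) /\
    joined b S e (2 * (4 * brad b)) (cinv (bchart b) hub) y.
  move=> [[cy sy] [i gi]]; have [yr yi] := sy.
  rewrite -(cmapK cy); set z := cmap _ y in sy gi yr yi *.
  case: i gi => gi.
    have sm : sq (bcenter b) (brad b) (mkC a0 (ImC z)) by split.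
    split.
      exact: joined_trans (joined_line (i := true) e0 eb sy sm _ _)
        (joined_line (i := false) e0 eb sm shub _ _).
    exact: joined_trans (joined_line (i := false) e0 eb shub sm _ _)
      (joined_line (i := true) e0 eb sm sy _ _).
  have sm : sq (bcenter b) (brad b) (mkC (ReC z) b0) by split.
  split.
    exact: joined_trans (joined_line (i := false) e0 eb sy sm _ _)
      (joined_line (i := true) e0 eb sm shub _ _).
  exact: joined_trans (joined_line (i := true) e0 eb shub sm _ _)
    (joined_line (i := false) e0 eb sm sy _ _).
have [h1 _] := to_hub u gu; have [_ h2] := to_hub v gv.
have := joined_trans h1 h2; rewrite (_ : 2 * (2 * (4 * brad b)) = 16 * brad b)//; ring.
Qed.

(** Squares are convex, so linear interpolation in the chart works. The homotopy takes place in [X]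
    and may pass through [S]. *)
Lemma region_homotopic X (b : box X) x y p q :
  path_in (reg b) x y p -> path_in (reg b) x y q -> path_homotopic X p q.
Proof.
move=> /path_inE[cp p0 p1 pr] /path_inE[cq q0 q1 qr].
pose f s t := lin (cmap (bchart b) (p (clamp t))) (cmap (bchart b) (q (clamp t))) (clamp s).
have fsq s t : sq (bcenter b) (brad b) (f s t).
  by apply: sq_convex (clamp_itv s); [exact: (pr _ (clamp_itv t)).2|exact: (qr _ (clamp_itv t)).2].
have cz g (cg : continuous (fun t => g (clamp t))) (gr : forall t, 0 <= t <= 1 -> reg b (g t)) (h : C -> R) :
    continuous h -> continuous (fun st : R * R => h (cmap (bchart b) (g (clamp st.2)))).
  move=> ch st; apply: (@at_cont_comp _ _ _ (fun st : R * R => cmap (bchart b) (g (clamp st.2)))).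
    apply: (@at_cont_comp _ _ _ (fun st : R * R => g (clamp st.2))).
      by apply: (@at_cont_comp _ _ _ (fun st : R * R => st.2) (fun t => g (clamp t)));
        [exact: cvg_snd|exact: cg].
    by apply: cmap_continuous; exact: (gr _ (clamp_itv _)).1.
  exact: ch.
have ctn (h1 h2 : R * R -> R) : continuous h1 -> continuous h2 ->
    continuous (fun st : R * R => h1 st + (h2 st - h1 st) * clamp st.1).
  move=> c1 c2; apply: contD => //; apply: contM.
    by apply: contD => //; exact: contN.
  apply: (@cont_comp _ _ _ (fun st : R * R => st.1) clamp); first exact: cont_fst.
  exact: continuous_clamp.
apply: (@homotopicI _ _ _ _ _ (fun st => cinv (bchart b) (f st.1 st.2))).
- move=> st.
  apply: (@at_cont_comp _ _ _ (fun st : R * R => f st.1 st.2)).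
    apply: continuousC_pair.
      have H : continuous (fun st : R * R =>
        ReC (cmap (bchart b) (p (clamp st.2))) + (ReC (cmap (bchart b) (q (clamp st.2))) -
         ReC (cmap (bchart b) (p (clamp st.2)))) * clamp st.1).
        have c1 := cz p cp pr _ (@continuous_ReC R); have c2 := cz q cq qr _ (@continuous_ReC R).
        exact: ctn c1 c2.
      exact: H.
    have H : continuous (fun st : R * R =>
        ImC (cmap (bchart b) (p (clamp st.2))) + (ImC (cmap (bchart b) (q (clamp st.2))) -
         ImC (cmap (bchart b) (p (clamp st.2)))) * clamp st.1).
      have c1 := cz p cp pr _ (@continuous_ImC R); have c2 := cz q cq qr _ (@continuous_ImC R).
      exact: ctn c1 c2.
    exact: H.
  have [cx Xx xE] := box_cinv (sq_brad (fsq st.1 st.2)).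
  by rewrite -{1}xE; exact: cinv_continuous.
- by move=> s t _ _; have [] := box_cinv (sq_brad (fsq s t)).
- move=> t t01; rewrite /f /= (clamp_id (t := 0)) ?lexx ?ler01// lin0 clamp_id// cmapK//.
  by have [] := pr t t01.
- move=> t t01; rewrite /f /= (clamp_id (t := 1)) ?lexx ?ler01// lin1 clamp_id// cmapK//.
  by have [] := qr t t01.
have linzz z t : lin z z t = z by rewrite /lin !subrr !mul0r !addr0 mkC_eta.
move=> s s01; rewrite /f /= !(clamp_id (t := 0), clamp_id (t := 1)) ?lexx ?ler01//.
rewrite p0 p1 q0 q1 !linzz !cmapK//.
  by rewrite -p1; have [] := pr 1 _; rewrite ?lexx ?ler01.
by rewrite -p0; have [] := pr 0 _; rewrite ?lexx ?ler01.
Qed.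

End Reach.

(** * Following a path along good lines *)


Lemma min_lt_max (R : realDomainType) (a b : R) : a != b -> Num.min a b < Num.max a b.
Proof. by rewrite lt_max !gt_min !ltxx/= orbF; case: ltgtP. Qed.

Lemma min_max_perturb (R : realDomainType) (p p0 q q0 a m : R) :
  `|p - p0| < m -> `|q - q0| < m -> Num.min p0 q0 + m < a < Num.max p0 q0 - m ->
  Num.min p q <= a <= Num.max p q.
Proof.
rewrite !ltr_norml => /andP[p1 p2] /andP[q1 q2]; rewrite ge_min le_max.
have [_|_] := ltP p0 q0 => /andP[a1 a2]; apply/andP; split; apply/orP.
- by left; lra.
- by right; lra.
- by right; lra.
- by left; lra.
Qed.

Section Crossing.
Variables (R : realType) (T : topologicalType) (B : riemann_surface R T).
Variable d : riemannian_metric B.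
Local Notation C := (Cplx R).
Implicit Types (p q g : R -> T) (x y : T) (z : C) (X : set T) (S : seq T).
Local Notation box := (box d).
Local Notation nice := (nice d).

Lemma path_in_sub (X Y : set T) x y p : X `<=` Y -> path_in X x y p -> path_in Y x y p.
Proof. by move=> XY [h1 h2 h3 h4]; split=> //; exact: subset_trans XY. Qed.

(* By the intermediate value theorem, a horizontal segment of the first box
   crosses the lines of a fixed interval of lines of the second. *)
Lemma box_crossing X (b b' : box X) y : reg b y -> reg b' y ->
  exists2 A : R, 0 < A & forall S e, 0 < e -> e <= A / (size S).+1%:R ->
  exists w (s : R -> T), [/\ good_pt b S e w, good_pt b' S e w,
    path_in (reg b) y w s & path_in (reg b') y w s].
Proof.
move=> ry ry'; set c := bchart b; set c' := bchart b'; set x := cmap c y.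
have [cy sy] := ry.
pose phi (z : C) : C := cmap c' (cinv c z).
have nU : nbhs x [set z | sq (bcenter b) (brad b) z /\ reg b' (cinv c z)].
  have n1 : nbhs x (sq (bcenter b) (brad b)) by exact: nbhs_sq.
  have n2 : nbhs x (cinv c @^-1` reg b').
    have cc := cinv_continuous cy; apply: (cc (reg b')).
    by rewrite cmapK//; apply: open_nbhs_nbhs; split=> //; exact: open_coord_sq.
  by apply: filterS2 n1 n2.
have [eta eta0 etaU'] := (nbhsC_sq _ _).1 nU.
have etaU z : sq x eta z -> sq (bcenter b) (brad b) z /\ reg b' (cinv c z).
  by move=> [zr zi]; exact: etaU'.
have cphi z : sq x eta z -> {for z, continuous phi}.
  move=> /etaU[sz rz]; have [cz Xz zE] := box_cinv (sq_brad sz).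
  apply: (@at_cont_comp _ _ _ (cinv c) (cmap c')).
    by rewrite -{1}zE; exact: cinv_continuous.
  by apply: cmap_continuous; exact: rz.1.
pose r := eta / 2; have r0 : 0 < r by rewrite divr_gt0.
have reta : r < eta by rewrite /r; lra.
pose P (h : R) := mkC (ReC x - r) h; pose Q (h : R) := mkC (ReC x + r) h.
have sx (a h : R) : `|a| <= r -> `|h - ImC x| < eta -> sq x eta (mkC (ReC x + a) h).
  move=> ar hr; split=> //; rewrite /= addrAC subrr add0r; exact: le_lt_trans reta.
have sP h : `|h - ImC x| < eta -> sq x eta (P h).
  by move=> hr; apply: sx => //; rewrite normrN gtr0_norm.
have sQ h : `|h - ImC x| < eta -> sq x eta (Q h).
  by move=> hr; apply: sx => //; rewrite gtr0_norm.
have hx0 : `|ImC x - ImC x| < eta by rewrite subrr normr0.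
(* The two ends of the segment are distinct points of the surface, so at least one coordinate of the
   second chart separates them. *)
have [i fPQ] : exists i, coord i (phi (P (ImC x))) != coord i (phi (Q (ImC x))).
  have [Er|] := eqVneq (coord false (phi (P (ImC x)))) (coord false (phi (Q (ImC x)))); last first.
    by exists false.
  have [Ei|] := eqVneq (coord true (phi (P (ImC x)))) (coord true (phi (Q (ImC x)))); last first.
    by exists true.
  have Ephi : phi (P (ImC x)) = phi (Q (ImC x)) by exact: C_ext.
  have [sP1 rP] := etaU _ (sP _ hx0); have [sQ1 rQ] := etaU _ (sQ _ hx0).
  have : cinv c (P (ImC x)) = cinv c (Q (ImC x)).
    by rewrite -(cmapK rP.1) -(cmapK rQ.1) -/c' -/(phi _) -/(phi _) Ephi.
  have [_ _ PE] := box_cinv (sq_brad sP1); have [_ _ QE] := box_cinv (sq_brad sQ1).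
  move=> /(congr1 (cmap c)); rewrite PE QE => /(congr1 (@ReC R)) /=.
  by move=> h; exfalso; clear -h r0; lra.
pose f z := coord i (phi z).
have cf z : sq x eta z -> {for z, continuous f}.
  move=> sz; apply: at_cont_comp (cphi z sz) _.
  by rewrite /coord; case: (i); [exact: continuous_ImC|exact: continuous_ReC].
pose lo := Num.min (f (P (ImC x))) (f (Q (ImC x))).
pose hi := Num.max (f (P (ImC x))) (f (Q (ImC x))).
have lohi : lo < hi := min_lt_max fPQ.
(* The margin [m] leaves the middle third of []lo, hi[] for the choice of [a]. Heights [h] close to
   that of [x] move the values at both ends by less than [m], so [a] and [h] can be chosen
   independently and the value [a] is still attained. *)
pose m := (hi - lo) / 3; have m0 : 0 < m by rewrite divr_gt0// subr_gt0.
have cmk (a h : R) : {for h, continuous (fun u : R => mkC a u)}.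
  by apply: continuousC_pair; [exact: cst_continuous|exact: cvg_id].
have ncl (F : R -> C) (h0 : R) : (forall h, `|h - ImC x| < eta -> sq x eta (F h)) ->
    {for ImC x, continuous F} ->
    exists2 et, 0 < et & forall h, `|h - ImC x| < et -> `|f (F h) - f (F (ImC x))| < m.
  move=> sF cF; have cfF : {for ImC x, continuous (fun h => f (F h))}.
    by apply: at_cont_comp cF _; apply: cf; exact: sF.
  have n := (@cvgrPdist_lt _ _ _ (nbhs (ImC x)) (nbhs_filter _) _ _).1 cfF m m0.
  have /nbhs_normP[et et0 het] := n; exists et => // h hh.
  by rewrite distrC; apply: het => /=; rewrite distrC.
have [e1 e10 hP] := ncl P 0 sP (cmk _ _).
have [e2 e20 hQ] := ncl Q 0 sQ (cmk _ _).
pose e3 := Num.min eta (Num.min e1 e2).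
have e30 : 0 < e3 by rewrite !lt_min eta0 e10.
have itv1 : ImC x - e3 < ImC x + e3 by lra.
have itv2 : lo + m < hi - m by rewrite /m; lra.
have [A1 A10 H1] := fat_itv itv1.
have [A2 A20 H2] := fat_itv itv2.
exists (Num.min A1 A2); first by rewrite lt_min A10.
move=> S e e0 eA.
have n0 : 0 < (size S).+1%:R :> R by rewrite ltr0n.
move: eA; rewrite ler_pdivlMr// le_min => /andP[eA1 eA2].
have [h hi3 gh] := H1 [seq ImC (cmap c s) | s <- S].
have [a ai ga] := H2 [seq coord i (cmap c' s) | s <- S].
have glh : good_line c S e true h.
  move=> s sS _; apply: le_trans (gh _ (map_f _ sS)).
  by rewrite size_map ler_pdivlMr.
have gla : good_line c' S e i a.
  move=> s sS _; apply: le_trans (ga _ (map_f (fun s => coord i (cmap c' s)) sS)).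
  by rewrite size_map ler_pdivlMr.
have hx : `|h - ImC x| < e3 by move: hi3; rewrite /= in_itv/= ltr_distl.
move: (hx); rewrite !lt_min => /and3P[hxe hx1 hx2].
pose L (t : R) := mkC (ReC x - r + 2 * r * t) h.
have sL t : 0 <= t <= 1 -> sq x eta (L t).
  move=> t01; rewrite /L (_ : _ + _ = ReC x + (2 * t - 1) * r); last by ring.
  apply: sx => //; rewrite normrM (gtr0_norm r0) ler_piMl ?(ltW r0)//.
  by rewrite ler_norml; lra.
have cL : continuous L.
  move=> t; apply: continuousC_pair; last exact: cst_continuous.
  exact: (@continuous_line R (ReC x - r) (2 * r) t).
have L0 : L 0 = P h by rewrite /L mulr0 addr0.
have L1 : L 1 = Q h by rewrite /L /Q; congr mkC; ring.
(* At this time the good horizontal line of the first square meets the good line of the second. *)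
have [t t01 ft] : exists2 t, t \in `[0, 1]%R & f (L t) = a.
  apply: (@IVT R (fun t => f (L t)) 0 1 a); first exact: ler01.
    apply/subspace_continuousP => t /=; rewrite in_itv/= => t01.
    apply: cvg_within_filter; apply: (@at_cont_comp _ _ _ L f); first exact: cL.
    by apply: cf; exact: sL.
  rewrite L0 L1; apply: min_max_perturb (hP h hx1) (hQ h hx2) _.
  by move: ai; rewrite /= in_itv.
rewrite in_itv/= in t01.
have [sLt rLt] := etaU _ (sL t t01).
have [cw Xw wE] := box_cinv (sq_brad sLt).
have yE : cinv c x = y by rewrite /x cmapK.
have sp := seg_path (b := b) sy sLt; rewrite -/c -/x yE in sp.
exists (cinv c (L t)), (seg b x (L t)); split=> //.
- split; first exact: reg_cinv.
  by exists true; rewrite -/c wE.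
- split=> //; exists i; rewrite -/c' -/(phi (L t)) -/(f (L t)) ft; exact: gla.
- have [h1 h2 h3 _] := sp; split=> // _ [u /= + <-]; rewrite in_itv/= => u01.
  by apply: (etaU _ _).2; apply: sq_convex => //; [exact: sq_center|exact: sL].
Qed.

(** The path [g] between good points stands for [p] once the ends are joined by connectors inside
    the end squares. All connectors are allowed since they are unique up to homotopy in [X]. The
    constants depend on [p] but not on [S], [u] or [v]. *)
Definition reach X (b0 : box X) x p (b : box X) y := exists A k W : R,
  [/\ 0 < A, 0 < k, 0 < W & forall S e, 0 < e -> e <= A / (size S).+1%:R ->
   forall u v, good_pt b0 S e u -> good_pt b S e v ->
   exists2 g, nice (X `\` [set` S]) e k W u v g &
   forall s s' : R -> T, path_in (reg b0) x u s -> path_in (reg b) y v s' ->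
     path_homotopic X (path_concat p s') (path_concat s g)].

Lemma reach_region X (b : box X) x y p : path_in (reg b) x y p -> reach b x p b y.
Proof.
move=> hp; have [A A0 HA] := box_connect b.
exists A, (bmet b), (16 * brad b); split=> //; [exact: bmet_gt0|by rewrite mulr_gt0 ?brad_gt0|].
move=> S e e0 eA u v gu gv; have [g [hg ng]] := HA S e e0 eA u v gu gv.
exists g => // s s' hs hs'; apply: region_homotopic.
  exact: path_concat_in hp hs'.
exact: path_concat_in hs hg.
Qed.

(** A point [w] good for both squares, joined to [y] inside their intersection by [s1], links the
    two pieces: [p p' s' ~ p s1 g2 ~ s g1 g2]. *)
Lemma reach_step X (b0 b b' : box X) x y y' p p' : path_in X x y p ->
  reach b0 x p b y -> reg b y -> path_in (reg b') y y' p' ->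
  reach b0 x (path_concat p p') b' y'.
Proof.
move=> hp [A1 [k1 [W1 [A10 k10 W10 H1]]]] ry hp'.
have ry' : reg b' y.
  by have [_ <- _] := path_inE hp'; apply; rewrite lexx ler01.
have [A2 A20 H2] := box_crossing ry ry'.
have [A3 A30 H3] := box_connect b'.
pose W := Num.max W1 (16 * brad b'); pose k := Num.min k1 (bmet b').
have k0 : 0 < k by rewrite lt_min k10 bmet_gt0.
have W0 : 0 < W by rewrite lt_max W10.
exists (Num.min A1 (Num.min A2 A3)), k, (2 * W); split=> //.
- by rewrite !lt_min A10 A20.
- by rewrite mulr_gt0.
move=> S e e0 eA u v gu gv.
have n0 : 0 < (size S).+1%:R :> R by rewrite ltr0n.
move: eA; rewrite ler_pdivlMr// !le_min -!ler_pdivlMr// => /and3P[eA1 eA2 eA3].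
have [w [s1 [gw gw' hs1 hs1']]] := H2 S e e0 eA2.
have [g1 n1 hg1] := H1 S e e0 eA1 u w gu gw.
have [g2 [hg2 n2]] := H3 S e e0 eA3 w v gw' gv.
exists (path_concat g1 g2).
  apply: (@nice_concat _ _ _ _ _ _ _ _ _ w).
    by apply: nice_le n1; rewrite ?(ltW k0)// ?ge_min ?le_max ?lexx.
  by apply: nice_le n2; rewrite ?(ltW k0)// ?ge_min ?le_max ?lexx ?orbT.
move=> s s' hs hs'.
have subX (z : box X) := path_in_sub (@reg_sub _ _ _ _ X z).
have hg1X : path_in X u w g1.
  by apply: (@path_in_sub (X `\` [set` S])); [exact: subDsetl|case: n1].
have [_ _ p1 _] := path_inE hp; have [_ p'0 _ _] := path_inE hp'.
have [_ g20 _ _] := path_inE hg2.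
apply: homotopic_trans (homotopic_assoc hp (subX _ _ _ _ hp') (subX _ _ _ _ hs')) _.
apply: (@homotopic_trans _ _ _ _ (path_concat p (path_concat s1 g2))).
  apply: homotopic_concat; first exact: homotopic_refl hp.
    apply: (@region_homotopic _ _ _ _ _ b'); first exact: path_concat_in hp' hs'.
    exact: path_concat_in hs1' hg2.
  by rewrite p1 /path_concat invr_ge0 ler0n mulr0 p'0.
apply: homotopic_trans (homotopic_sym (homotopic_assoc hp (subX _ _ _ _ hs1) (subX _ _ _ _ hg2))) _.
apply: homotopic_trans (homotopic_assoc (subX _ _ _ _ hs) hg1X (subX _ _ _ _ hg2)).
apply: homotopic_concat; first exact: hg1.
  exact: homotopic_refl (subX _ _ _ _ hg2).
have [_ _ -> _] := path_inE (path_concat_in hp (subX _ _ _ _ hs1)).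
by rewrite g20.
Qed.

Lemma reach_homotopic X (b0 b : box X) x y p p' : path_in X x y p ->
  path_homotopic X p p' -> reach b0 x p b y -> reach b0 x p' b y.
Proof.
move=> hp pp' [A [k [W [A0 k0 W0 H]]]]; exists A, k, W; split=> // S e e0 eA u v gu gv.
have [g ng hg] := H S e e0 eA u v gu gv; exists g => // s s' hs hs'.
apply: homotopic_trans (hg s s' hs hs').
have hs'X := path_in_sub (@reg_sub _ _ _ _ X b) hs'.
apply: homotopic_concat; [exact: homotopic_sym|exact: homotopic_refl hs'X|].
have [_ ->] := homotopic_ends pp'.
by have [_ _ -> _] := path_inE hp; have [_ -> _ _] := path_inE hs'X.
Qed.

Lemma subpath_in X x y p (a c : R) : path_in X x y p -> 0 <= a -> a <= c -> c <= 1 ->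
  path_in X (p a) (p c) (fun t => p (a + (c - a) * t)).
Proof.
move=> hp a0 ac c1; have [cp _ _ pX] := path_inE hp.
have H t : 0 <= t <= 1 -> 0 <= a + (c - a) * t <= 1 by move=> *; nra.
apply: (@path_inI _ _ _ _ _ _ (fun t => p (clamp (a + (c - a) * t)))).
- apply: (@cont_comp _ _ _ (fun t : R => a + (c - a) * t) _ _ cp); exact: continuous_line.
- by move=> t t01; rewrite clamp_id// H.
- by rewrite mulr0 addr0.
- by rewrite mulr1 addrC subrK.
- by move=> t t01; apply: pX; exact: H.
Qed.

(** A supremum argument over the parameters up to which the path can be followed plays the part of a
    finite subdivision. *)
Lemma reach_path X (b0 : box X) x y p : open X -> path_in X x y p -> reg b0 x ->
  exists2 b, reg b y & reach b0 x p b y.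
Proof.
move=> oX hp r0; have [cp p0 p1 pX] := path_inE hp.
pose P (t : R) := exists2 b, reg b (p t) & reach b0 x (fun u => p (t * u)) b (p t).
have P0 : P 0.
  exists b0; rewrite p0//; apply: reach_region.
  apply: (@path_inI _ _ _ _ _ _ (cst x)) => //; first exact: cst_continuous.
  - by move=> t _; rewrite mul0r p0.
  - by rewrite mul0r p0.
  - by rewrite mul0r p0.
  - by move=> t _; rewrite mul0r p0.
(* One square around [p t] contains the path near [t], so a single step leads from any earlier
   parameter [a] nearby to any later [c]. *)
have local (t : R) : 0 <= t <= 1 -> exists2 e : R, 0 < e &
    forall a c, 0 <= a -> a <= c -> c <= 1 -> `|a - t| < e -> `|c - t| < e -> P a -> P c.
  move=> t01; have [b rb] := box_at d oX (pX t t01).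
  have n : nbhs t (fun u => reg b (p (clamp u))).
    apply: (cp t (reg b)); rewrite clamp_id//.
    by apply: open_nbhs_nbhs; split=> //; exact: open_coord_sq.
  have /nbhs_normP[e /= e0 he] := n; exists e => // a c a0 ac c1 ea ec [b1 r1 h1].
  have inb u : a <= u <= c -> reg b (p u).
    move=> /andP[au uc]; have := he u; rewrite /= clamp_id; last by rewrite (le_trans a0)// (le_trans uc).
    apply; move: ea ec; rewrite distrC [ `|c - t| ]distrC !ltr_norml.
    by move=> /andP[? ?] /andP[? ?]; apply/andP; split; lra.
  have hac : path_in (reg b) (p a) (p c) (fun u => p (a + (c - a) * u)).
    have [h2 h3 h4 _] := subpath_in hp a0 ac c1; split=> // _ [u /= + <-].
    by rewrite in_itv/= => u01; apply: inb; nra.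
  have ha : path_in X x (p a) (fun u => p (a * u)).
    have := subpath_in hp (lexx 0) a0 (le_trans ac c1).
    by rewrite p0 subr0; under eq_fun do rewrite add0r.
  exists b; first by apply: inb; rewrite ac lexx.
  apply: reach_homotopic (path_concat_in ha (path_in_sub (@reg_sub _ _ _ _ X b) hac))
    _ (reach_step ha h1 r1 hac).
  exact: homotopic_sym (homotopic_split hp a0 ac c1).
pose A := [set t : R | 0 <= t <= 1 /\ P t].
have A0 : A 0 by split; rewrite // lexx ler01.
have Aub : ubound A 1 by move=> t [/andP[]].
have supA : has_sup A by split; [exists 0|exists 1].
pose s := sup A.
have s0 : 0 <= s by apply: ub_le_sup => //; exists 1.
have s1 : s <= 1 by apply: ge_sup => //; exists 0.
have [e e0 he] := local s (introT andP (conj s0 s1)).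
have [t [/andP[t0 t1] Pt] st] := sup_adherent e0 supA.
have ts : t <= s by apply: ub_le_sup; [exists 1|split=> //; apply/andP].
have te : `|t - s| < e.
  by rewrite distrC ger0_norm ?subr_ge0//; move: st; rewrite -/s => st; clear -st ts; lra.
(* This parameter is reachable and would exceed the supremum unless it equals 1. *)
pose c := Num.min 1 (s + e / 2).
have c1 : c <= 1 by rewrite ge_min lexx.
have sc : s <= c by rewrite le_min s1 lerDl divr_ge0// ltW.
have Pc : P c.
  apply: (he t) => //; first exact: le_trans sc.
  rewrite ger0_norm ?subr_ge0//; have : c <= s + e / 2 by rewrite ge_min lexx orbT.
  by move=> cse; clear -e0 cse; lra.
have cs : c <= s by apply: ub_le_sup; [exists 1|split=> //; apply/andP; split=> //; exact: le_trans sc].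
have cE : c = 1.
  have [h|h] := leP 1 (s + e / 2); first by rewrite /c; apply/min_idPl.
  have cE : c = s + e / 2 by rewrite /c; apply/min_idPr/ltW.
  by move: cs; rewrite cE gerDl leNgt divr_gt0.
move: Pc; rewrite cE => -[b rb hb]; exists b; first by rewrite -p1.
by move: hb; rewrite p1; under eq_fun do rewrite mul1r.
Qed.

(** Following the loop may end in another square around [x]; one more step along the constant path
    returns to [b]. *)
Lemma reach_loop X (b : box X) x p : open X -> path_in X x x p -> reg b x ->
  reach b x p b x.
Proof.
move=> oX hp rx; have [b1 r1 h1] := reach_path oX hp rx.
have hc := path_cst_in R rx.
apply: reach_homotopic (path_concat_in hp (path_in_sub (@reg_sub _ _ _ _ X b) hc)) _ (reach_step hp h1 r1 hc).
exact: homotopic_idr hp.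
Qed.

End Crossing.

(** * Choice of the base point and of the loops *)


Lemma compact_unit_disc (R : realType) : compact [set z : Cplx R | `|z| <= 1].
Proof.
pose Q : set (R * R) := `[-1, 1] `*` `[-1, 1].
have normE (z : Cplx R) : (`|z| <= 1 :> Cplx R) = (Num.sqrt (ReC z ^+ 2 + ImC z ^+ 2) <= 1).
  by rewrite /Cplx normc_def -lecR.
have cQ : compact ((fun ab : R * R => mkC ab.1 ab.2) @` Q).
  apply: continuous_compact; last first.
    by apply: compact_setX; exact: segment_compact.
  apply: continuous_subspaceT => ab.
  by apply: continuousC_pair; [exact: cvg_fst|exact: cvg_snd].
apply: (subclosed_compact _ cQ).
  have cf : continuous (fun z : Cplx R => Num.sqrt (ReC z * ReC z + ImC z * ImC z)).
    move=> z; apply: (@at_cont_comp _ _ _ (fun z : Cplx R => ReC z * ReC z + ImC z * ImC z)).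
      by apply: at_contD; apply: at_contM; (exact: continuous_ReC || exact: continuous_ImC).
    exact: sqrt_continuous.
  rewrite (_ : [set z : Cplx R | _] =
    (fun z : Cplx R => Num.sqrt (ReC z * ReC z + ImC z * ImC z)) @^-1` [set x | x <= 1]).
    by apply: preimage_closed; [move=> z _; exact: cf|exact: closed_le].
  by apply/seteqP; split=> z /=; rewrite normE !expr2.
move=> z /=; rewrite normE => z1; exists (ReC z, ImC z); last exact: mkC_eta.
have h1 := le_trans (ReC_le_sqrt z) z1; have h2 := le_trans (ImC_le_sqrt z) z1.
by split; rewrite /= in_itv/= -ler_norml.
Qed.

Lemma closed_disc_closed (R : realType) (T : topologicalType) (D : set T) :
  hausdorff_space T -> closed_disc R D -> closed D.
Proof.
move=> hT [f [cf _ ->]]; apply: compact_closed => //.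
by apply: continuous_compact => //; exact: compact_unit_disc.
Qed.

Lemma finite_pos_lb (R : realFieldType) (k : nat) (f : 'I_k -> R) : (forall i, 0 < f i) ->
  exists2 a, 0 < a & forall i, a <= f i.
Proof.
move=> f0; have s0 : 0 < 1 + \sum_i (f i)^-1.
  by rewrite ltr_wpDr// sumr_ge0// => i _; rewrite invr_ge0 ltW.
exists (1 + \sum_i (f i)^-1)^-1; first by rewrite invr_gt0.
move=> i; rewrite invf_ple ?posrE// (bigD1 i)//= addrCA lerDl addr_ge0//.
by rewrite sumr_ge0// => j _; rewrite invr_ge0 ltW.
Qed.

Lemma finite_ub (R : realFieldType) (k : nat) (f : 'I_k -> R) : (forall i, 0 < f i) ->
  exists2 a, 0 < a & forall i, f i <= a.
Proof.
move=> f0; exists (1 + \sum_i f i).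
  by rewrite ltr_wpDr// sumr_ge0// => i _; exact: ltW.
move=> i; rewrite (bigD1 i)//= addrCA lerDl addr_ge0//.
by rewrite sumr_ge0// => j _; exact: ltW.
Qed.

(** Here [t] is an inverse of [s], so [c ~ q s], while [g ~ s^-1 q^-1 p q s]. Hence [c g ~ p c], and
    [c] cancels on the right. *)
Lemma conjugate_homotopic (R : realType) (T : topologicalType) (X : set T) (x y : T)
    (p q c s t g : R -> T) :
  path_in X x x p -> path_in X x x q -> path_in X x y c -> path_in X x y s ->
  path_in X y x t -> path_in X y y g ->
  path_homotopic X (path_concat c t) q -> path_homotopic X (path_concat t s) (cst y) ->
  path_homotopic X (path_concat (path_concat (path_rev q) (path_concat p q)) s) (path_concat s g) ->
  path_homotopic X p (path_concat (path_concat c g) (path_rev c)).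
Proof.
move=> hp hq hc hs ht hg ctq ts H.
have hrq := path_rev_in hq; have hrc := path_rev_in hc.
have e (z z' : T) (r : R -> T) (hr : path_in X z z' r) : r 0 = z /\ r 1 = z'.
  by have [_ -> -> _] := path_inE hr.
have rf (z z' : T) (r : R -> T) (hr : path_in X z z' r) := homotopic_refl hr.
have hpq := path_concat_in hp hq; have hqs := path_concat_in hq hs.
have hde := path_concat_in hrq hpq.
(* [c ~ q.s], and conjugating [s] turns [g] into [q^-1.p.q]. *)
have cqs : path_homotopic X c (path_concat q s).
  apply: homotopic_trans (homotopic_sym (homotopic_idr hc)) _.
  apply: (@homotopic_trans _ _ _ _ (path_concat c (path_concat t s))).
    apply: homotopic_concat (rf _ _ _ hc) (homotopic_sym ts) _.
    by rewrite (e _ _ _ hc).2.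
  apply: homotopic_trans (homotopic_sym (homotopic_assoc hc ht hs)) _.
  apply: homotopic_concat ctq (rf _ _ _ hs) _.
  by rewrite (e _ _ _ (path_concat_in hc ht)).2 (e _ _ _ hs).1.
have cg : path_homotopic X (path_concat c g) (path_concat p c).
  apply: (@homotopic_trans _ _ _ _ (path_concat (path_concat q s) g)).
    apply: homotopic_concat cqs (rf _ _ _ hg) _.
    by rewrite (e _ _ _ hc).2 (e _ _ _ hg).1.
  apply: homotopic_trans (homotopic_assoc hq hs hg) _.
  apply: (@homotopic_trans _ _ _ _
    (path_concat q (path_concat (path_concat (path_rev q) (path_concat p q)) s))).
    apply: homotopic_concat (rf _ _ _ hq) (homotopic_sym H) _.
    by rewrite (e _ _ _ hq).2 (e _ _ _ (path_concat_in hs hg)).1.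
  apply: homotopic_trans (homotopic_sym (homotopic_assoc hq hde hs)) _.
  apply: (@homotopic_trans _ _ _ _ (path_concat (path_concat p q) s)).
    apply: homotopic_concat _ (rf _ _ _ hs) _; last first.
      by rewrite (e _ _ _ (path_concat_in hq hde)).2 (e _ _ _ hs).1.
    apply: homotopic_trans (homotopic_sym (homotopic_assoc hq hrq hpq)) _.
    apply: homotopic_trans (homotopic_idl hpq).
    apply: homotopic_concat (homotopic_invr hq) (rf _ _ _ hpq) _.
    by rewrite (e _ _ _ (path_concat_in hq hrq)).2 (e _ _ _ hpq).1.
  apply: homotopic_trans (homotopic_assoc hp hq hs) _.
  apply: homotopic_concat (rf _ _ _ hp) (homotopic_sym cqs) _.
  by rewrite (e _ _ _ hp).2 (e _ _ _ hqs).1.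
apply: homotopic_sym.
apply: (@homotopic_trans _ _ _ _ (path_concat (path_concat p c) (path_rev c))).
  apply: homotopic_concat cg (rf _ _ _ hrc) _.
  by rewrite (e _ _ _ (path_concat_in hc hg)).2 (e _ _ _ hrc).1.
apply: homotopic_trans (homotopic_assoc hp hc hrc) _.
apply: homotopic_trans (homotopic_idr hp).
apply: homotopic_concat (rf _ _ _ hp) (homotopic_invr hc) _.
by rewrite (e _ _ _ hp).2 (e _ _ _ (path_concat_in hc hrc)).1.
Qed.

Section NiceConsequences.
Variables (R : realType) (T : topologicalType) (B : riemann_surface R T).
Variable d : riemannian_metric B.

Lemma nice_kobayashi_length X (e k W : R) u v g : 0 < e -> 0 < W ->
  nice d X e k W u v g -> (kobayashi_length B X g <= (2 * W / e)%:E)%E.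
Proof.
move=> e0 W0 [_ _ _ [N hN]]; apply: (@integral01_le _ _ _ N).
- by move=> t; exact: kobayashi_ge0.
- by rewrite divr_ge0 ?mulr_ge0 ?ltW.
- by move=> t t01 tN; apply: slow_kobayashi => //; exact: hN.
Qed.

(** The bound on [r] is strict because the tube is defined by a large inequality. *)
Lemma nice_tube X (e k W r : R) u v g : 0 < e -> 0 < k -> r < k * (e / 2) ->
  nice d X e k W u v g -> tube d (g @` `[0, 1]) r `<=` X.
Proof.
move=> e0 k0 rke [_ _ hs _] x /= hx; apply: contrapT => nXx.
suff : (r%:E < riem_dist_set d x (g @` `[0%R, 1%R]))%E by rewrite ltNge hx.
apply: (@lt_le_trans _ _ (k * (e / 2))%:E); first by rewrite lte_fin.
apply: le_ereal_inf_tmp => _ [_ [t /= + <-] <-]; rewrite in_itv/= => t01.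
exact: safe_dist (hs t t01) nXx.
Qed.
End NiceConsequences.

(** Words over a finite alphabet are countable and represent every class. The interval is therefore
    a countable union of sets on which one word represents the class of [q y], and one of these sets
    is fat. *)
Lemma fat_class (R : realType) (T : topologicalType) (X : set T) (x : T) (k : nat)
    (alpha : 'I_k -> set (R -> T)) (rel : set (word 'I_k)) (q : R -> R -> T) (a b : R) :
  a < b -> presents X x alpha rel -> (forall y, a < y < b -> loop_in X x (q y)) ->
  exists q0 E, [/\ loop_in X x q0, fat E & forall y, E y ->
    a < y < b /\ path_homotopic X (q y) q0].
Proof.
move=> ab [_ gen _] hq.
pose E m := [set y : R | a < y < b /\
  exists2 w, choice.unpickle m = Some w & eval_word X x alpha w = loop_class X x (q y)].
have [|m fE] := @fat_cover _ E a b ab.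
  move=> y; rewrite /= in_itv/= => yab.
  have [|w wE] := gen (loop_class X x (q y)); first by exists (q y) => //; exact: hq.
  by exists (choice.pickle w) => //; split=> //; exists w; rewrite ?choice.pickleK.
(* Fatness tested on the empty list says that the set is inhabited; any member supplies the common
   class. *)
have [A A0 fA] := fE; have [y0 [y0ab [w0 w0E w0q]] _] := fA [::].
exists (q y0), (E m); split=> //; first exact: hq.
move=> y [yab [w wE wq]]; split=> //.
have : loop_class X x (q y0) (q y0).
  by split; [exact: hq|exact: homotopic_refl (hq _ y0ab)].
by rewrite -w0q; move: wE; rewrite w0E => -[->]; rewrite wq => -[].
Qed.

Unset Implicit Arguments.

Theorem theorem5p1 (R : realType) (T : topologicalType)
    (B : riemann_surface R T) (d : riemannian_metric B)
    (B_compact : compact [set: T]) (B_connected : connected [set: T])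
    (r : nat) (D : 'I_r -> set T)
    (D_disc : forall j, closed_disc R (D j))
    (D_disjoint : trivIset [set: 'I_r] D)
    (B1 : set T) (B1E : B1 = ~` \bigcup_j D j)
    (b1 : T) (B1b1 : B1 b1)
    (k : nat) (alpha : 'I_k -> set (R -> T))
    (alpha_base : simple_base B B1 b1 alpha r)
    (c : T -> R -> T) (c_paths : connecting_paths d B1 b1 c) :
  exists A L : R, [/\ 0 < A, 0 < L &
    forall S : {fset T}, [set` S] `<=` B1 ->
    exists (b : T) (gamma : 'I_k -> R -> T),
      (B1 `\` [set` S]) b /\
      forall i : 'I_k,
        [/\ loop_in (B1 `\` [set` S]) b (gamma i),
            piecewise_smooth B (gamma i),
            represents_up_to_conj (c b) (gamma i) (alpha i),
            (kobayashi_length B (B1 `\` [set` S]) (gamma i)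
               <= (L * (#|` S|%:R + 1))%:E)%E
          & S != fset0 ->
            tube d (gamma i @` `[0, 1]) (A * (#|` S|%:R)^-1)
              `<=` B1 `\` [set` S]]].
Proof.
have hT := rs_hausdorff B.
have oB1 : open B1.
  rewrite B1E openC; apply: closed_bigcup; first exact: finite_finset.
  by move=> j _; exact: closed_disc_closed (D_disc j).
have [b0 r0] := box_at d oB1 B1b1.
set z0 := bcenter b0; set rho := brad b0; set c0 := bchart b0.
have rho0 : 0 < rho by exact: brad_gt0.
have [rel pres] : exists rel, presents B1 b1 alpha rel.
  by case: alpha_base => -[gg [[_ h]|[_ _ h]]] _; [eexists; exact: h|exists set0].
(* Candidate base points lie on the vertical midline of a square around [b1] and are indexed by
   their height. *)
pose bz (y : R) : Cplx R := mkC (ReC z0) y.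
have bzsq y : ImC z0 - rho < y < ImC z0 + rho -> sq z0 rho (bz y).
  by move=> yi; split; rewrite /= ?subrr ?normr0// ltr_distl.
have z1sq := r0.2; rewrite -/c0 -/z0 -/rho /= in z1sq.
have b1K : cinv c0 (cmap c0 b1) = b1 by rewrite cmapK//; exact: r0.1.
pose pt (y : R) := cinv c0 (bz y).
pose s y := seg b0 (cmap c0 b1) (bz y); pose t y := seg b0 (bz y) (cmap c0 b1).
have hs y : ImC z0 - rho < y < ImC z0 + rho -> path_in (reg b0) b1 (pt y) (s y).
  by move=> yi; have := seg_path z1sq (bzsq y yi); rewrite -/c0 b1K.
have ht y : ImC z0 - rho < y < ImC z0 + rho -> path_in (reg b0) (pt y) b1 (t y).
  by move=> yi; have := seg_path (bzsq y yi) z1sq; rewrite -/c0 b1K.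
have subB := @path_in_sub R T _ _ _ _ _ (@reg_sub _ _ _ _ _ b0).
have ptB1 y : ImC z0 - rho < y < ImC z0 + rho -> B1 (pt y).
  by move=> yi; apply: (reg_sub (b := b0)); exact: reg_cinv (bzsq y yi).
have hc y : ImC z0 - rho < y < ImC z0 + rho -> path_in B1 b1 (pt y) (c (pt y)).
  by move=> yi; exact: (c_paths.1 _ (ptB1 y yi)).1.
have itv : ImC z0 - rho < ImC z0 + rho by lra.
(* The loop [q] is the common class of [c_b] closed up by the segment from [b] to [b1], for all
   heights in the fat set [E]. *)
have [|q [E [hq [A0 A00 fA0] hE]]] :=
  fat_class (q := fun y => path_concat (c (pt y)) (t y)) itv pres.
  by move=> y yi; apply: path_concat_in (hc y yi) _; exact: subB (ht y yi).
have /choice[p hp] : forall i, exists p, loop_in B1 b1 p /\ alpha i = loop_class B1 b1 p.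
  by move=> i; have [a1 _ _] := pres; have [p h1 h2] := a1 i; exists p.
(* Closing up [c_b] costs a conjugation by [q], which is compensated in advance. *)
pose delta i := path_concat (path_rev q) (path_concat (p i) q).
have hdelta i : path_in B1 b1 b1 (delta i).
  by apply: path_concat_in (path_rev_in hq) _; exact: path_concat_in (hp i).1 hq.
have /choice[f hf] : forall i, exists f : R * R * R, [/\ 0 < f.1.1, 0 < f.1.2, 0 < f.2 &
    forall (S : seq T) e, 0 < e -> e <= f.1.1 / (size S).+1%:R ->
   forall u v, good_pt b0 S e u -> good_pt b0 S e v ->
   exists2 g, nice d (B1 `\` [set` S]) e f.1.2 f.2 u v g &
   forall s s', path_in (reg b0) b1 u s -> path_in (reg b0) b1 v s' ->
     path_homotopic B1 (path_concat (delta i) s') (path_concat s g)].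
  move=> i; have [A [kk [W H]]] := reach_loop oB1 (hdelta i) r0.
  by exists (A, kk, W).
have [A1 A10 hA1] := @finite_pos_lb _ _ (fun i => (f i).1.1) (fun i => let: And4 h _ _ _ := hf i in h).
have [K K0 hK] := @finite_pos_lb _ _ (fun i => (f i).1.2) (fun i => let: And4 _ h _ _ := hf i in h).
have [W W0 hW] := @finite_ub _ _ (fun i => (f i).2) (fun i => let: And4 _ _ h _ := hf i in h).
(* [A0] serves to place the base point, [A1] to follow all the loops. *)
pose A := Num.min A0 A1; have Apos : 0 < A by rewrite lt_min A00.
(* With [e = A / (n + 1)], the length bound [2 * W / e] is [(2 * W / A) * (n + 1)]. The distance
   bound [K * e / 2] is at least [K * A / (4 * n)] because [n + 1 <= 2 * n]; a further factor 2
   makes the comparison strict. *)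
exists (K * A / 8), (2 * W / A); split; [by rewrite divr_gt0 ?mulr_gt0|by rewrite divr_gt0 ?mulr_gt0|].
move=> S SB1; pose S' : seq T := enum_fset S.
have SE : [set` S] = [set` S'] by apply/seteqP; split.
rewrite SE; set n := #|` S|.
have nE : size S' = n by [].
pose e := A / n.+1%:R.
have n0 : 0 < n.+1%:R :> R by rewrite ltr0n.
have e0 : 0 < e by rewrite divr_gt0.
have [y Ey hy] := fA0 [seq ImC (cmap c0 x) | x <- S'].
have [yi qy] := hE y Ey.
have ptE : cmap c0 (pt y) = bz y by have [] := box_cinv (sq_brad (bzsq y yi)).
have gpt : good_pt b0 S' e (pt y).
  split; first exact: reg_cinv (bzsq y yi).
  exists true => x xS cx; rewrite -/c0 ptE.
  apply: le_trans (hy _ (map_f (fun x => ImC (cmap c0 x)) xS)).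
  by rewrite size_map nE ler_pM2r ?invr_gt0// ge_min lexx.
have /choice[g hg] : forall i, exists g, nice d (B1 `\` [set` S']) e K W (pt y) (pt y) g /\
     path_homotopic B1 (path_concat (delta i) (s y)) (path_concat (s y) g).
  move=> i; have [_ _ _ H] := hf i.
  have [|g ng hg] := H S' e e0 _ _ _ gpt gpt.
    by rewrite nE ler_pM2r ?invr_gt0// ge_min hA1 orbT.
  exists g; split; first exact: nice_le (ltW K0) (hK i) (hW i) ng.
  by apply: hg; exact: hs.
exists (pt y), g; split.
  split; first exact: ptB1.
  (* If [b] were in [S], the good line through it would be at distance 0 from the line through a
     point of [S]. *)
  move=> /= yS; have [_ [j gj]] := gpt; have := gj _ yS (reg_cinv (bzsq y yi)).1.
  by rewrite subrr normr0 leNgt e0.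
move=> i; have [ng hgi] := hg i; have [gl gs _ _] := ng.
have glB1 : path_in B1 (pt y) (pt y) (g i) := path_in_sub (@subDsetl _ _ _) gl.
split=> //.
- exact: pws_piecewise_smooth.
- rewrite /represents_up_to_conj (hp i).2; split.
    apply: path_concat_in (path_rev_in (hc y yi)).
    exact: path_concat_in (hc y yi) glB1.
  apply: (conjugate_homotopic (hp i).1 hq (hc y yi) (subB _ _ _ (hs y yi))
            (subB _ _ _ (ht y yi)) glB1 qy _ hgi).
  apply: region_homotopic (path_concat_in (ht y yi) (hs y yi)) _.
  by apply: path_cst_in; exact: reg_cinv (bzsq y yi).
- apply: le_trans (nice_kobayashi_length e0 W0 ng) _.
  by rewrite lee_fin /e invf_div natr1 [leLHS]mulrA [leLHS]mulrAC.
- move=> S0; have npos : (0 < n)%N by rewrite cardfs_gt0.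
  apply: (nice_tube e0 K0 _ ng).
  rewrite /e ltr_pdivrMr ?ltr0n//.
  have -> : K * (A / n.+1%:R / 2) * n%:R = K * A / 2 * (n%:R / n.+1%:R).
    by move: (n.+1%:R^-1 : R) => v; ring.
  have h : 2^-1 <= n%:R / n.+1%:R :> R.
    by rewrite ler_pdivlMr// mulrC ler_pdivrMr// -natrM ler_nat muln2 -addnn -[n.+1]add1n leq_add2r.
  have KA : 0 < K * A by rewrite mulr_gt0.
  apply: (@lt_le_trans _ _ (K * A / 2 * 2^-1)); first by lra.
  by rewrite ler_pM2l// divr_gt0.
Qed.
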